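(* Assume $b_1=1$ (i.e. $q_1>q_2$), $\varepsilon=\hbar(k+N-q_l)$, $n_a-n_{a+1}\ge3$ for all $1\le a\le v$, and $k+N-q_l\neq0$. Then for every $2\le a\le v$ the image of $$\Phi_a\colon Y_{\hbar,\varepsilon-(n_a-q_l)\hbar}(\widehat{\mathfrak{sl}}(n_a-n_{a+1}))\to\mathcal{U}(\mathcal{W}^k(\mathfrak{gl}(N),f))$$ is contained in the universal enveloping algebra $\mathcal{U}\big(C(\mathcal{W}^k(\mathfrak{gl}(N),f),V^\kappa(\mathfrak{sl}(n_1-n_2)))\big)$ of the coset vertex algebra.
   Context: **Partition data.** $\hbar\in\mathbb{C}\setminus\{0\}$, $k\in\mathbb{C}$; $N=q_1+\dots+q_l$ with integers $q_1\geq\cdots\geq q_l\geq 1$. Let $n_1>n_2>\dots>n_v$ be the distinct values of the $q_i$ (so $n_1=q_1$, $n_v=q_l$), $n_{v+1}=0$, and $b_a=\#\{i: q_i\geq n_a\}$. Put $\alpha_s=k+N-q_s$, $\gamma_s=\sum_{u=s+1}^l\alpha_u$. **W-algebra.** For $1\le i\le N$ let $\mathrm{col}(i)=s$ if $\sum_{j<s}q_j<i\le\sum_{j\le s}q_j$, and $\mathrm{row}(i)=i-\sum_{j<\mathrm{col}(i)}q_j+q_1-q_{\mathrm{col}(i)}$. Let $f=\sum_j E_{\hat j,j}$, where $\mathrm{col}(\hat j)=\mathrm{col}(j)+1$, $\mathrm{row}(\hat j)=\mathrm{row}(j)$ (sum over those $j$ for which $\hat j$ exists). On $\mathfrak{gl}(N)$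 use the form $(E_{i,j}|E_{p,q})=k\delta_{i,q}\delta_{p,j}+\delta_{i,j}\delta_{p,q}$. $\mathcal{W}^k(\mathfrak{gl}(N),f)$ is the vertex algebra obtained by quantum Drinfeld–Sokolov reduction of the universal affine vertex algebra of $\mathfrak{gl}(N)$ with this form, with respect to $f$ (good grading $\deg E_{i,j}=\mathrm{col}(j)-\mathrm{col}(i)$). On $\mathfrak{gl}(q_s)$ let $\kappa_s(E_{i,j},E_{p,q})=\alpha_s\delta_{j,p}\delta_{i,q}+\delta_{i,j}\delta_{p,q}$. Via the Miura map (induced by projection of $\bigoplus_{\mathrm{col}(i)\ge\mathrm{col}(j)}\mathbb{C}E_{i,j}$ to its block-diagonal part $\bigoplus_s\mathfrak{gl}(q_s)$), $\mathcal{W}^k(\mathfrak{gl}(N),f)$ is a vertex subalgebra of $\bigotimes_{s=1}^lV^{\kappa_s}(\mathfrak{gl}(q_s))$, where $V^{\kappa_s}(\mathfrak{gl}(q_s))=U(t^{-1}\mathfrak{gl}(q_s)[t^{-1}])$ is the universal affine vertex algebra. **Elements $W^{(r)}_{p,q}$.** Write $E^{(s)}_{i+(q_1-q_s),j+(q_1-q_s)}[-u]$ for $E_{i,j}t^{-u}$ in the $s$-th factor, and $E^{(s)}_{p,q}[-u]=0$ unless $q_1-q_s<p,q\le q_1$. For $1\le a\le v$ and $q_1-n_a<p,q\le q_1-n_{a+1}$, the following are elements of $\mathcal{W}^k(\mathfrak{gl}(N),f)$: $W^{(1)}_{p,q}=\sum_{r=1}^lE^{(r)}_{p,q}[-1]$,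 $W^{(2)}_{p,q}=-\sum_{r=1}^l\gamma_rE^{(r)}_{p,q}[-2]+\sum_{r_1<r_2,\ u>q_1-n_a}E^{(r_1)}_{u,q}[-1]E^{(r_2)}_{p,u}[-1]-\sum_{r_1\ge r_2,\ q_1-q_{r_2}<u\le q_1-n_a}E^{(r_1)}_{u,q}[-1]E^{(r_2)}_{p,u}[-1]$. **Coset.** For a vertex subalgebra $B\subset A$, $C(A,B)=\{v\in A\mid w_{(r)}v=0\text{ for all }w\in B,\ r\ge0\}$. When $b_1=1$, the universal affine vertex algebra $V^\kappa(\mathfrak{gl}(n_1-n_2))$ with $\kappa(E_{i,j},E_{p,q})=(k+N-q_1)\delta_{i,q}\delta_{p,j}+\delta_{i,j}\delta_{p,q}$ embeds in $\mathcal{W}^k(\mathfrak{gl}(N),f)$ by $E_{i,j}t^{-1}\mapsto W^{(1)}_{i,j}$ ($1\le i,j\le n_1-n_2$); $V^\kappa(\mathfrak{sl}(n_1-n_2))$ is the vertex subalgebra generated by $\mathfrak{sl}(n_1-n_2)$ under this embedding. **Enveloping algebra of a vertex algebra.** For a vertex algebra $V$, $L(V)=V\otimes\mathbb{C}[t^{\pm1}]/\mathrm{Im}(\partial\otimes\mathrm{id}+\mathrm{id}\otimes\frac{d}{dt})$ with $[ut^a,vt^b]=\sum_{r\ge0}\binom{a}{r}(u_{(r)}v)t^{a+b-r}$. $\mathcal{U}(V)$ is the quotient of the standard degreewise completion of $U(L(V))$ by the completed two-sided ideal generated by $(u_{(a)}v)t^b-\sum_{i\ge0}\binom{a}{i}(-1)^i(ut^{a-i}vt^{b+i}-(-1)^avt^{a+b-i}ut^i)$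 and $|0\rangle t^{-1}-1$. In $\mathcal{U}(V)$ an element $w\in V$ written without a power of $t$ means $wt^0$. **Affine Yangian.** For $n\ge3$ and parameters $\hbar,\varepsilon$, $Y_{\hbar,\varepsilon}(\widehat{\mathfrak{sl}}(n))$ is the associative algebra generated by $X^\pm_{i,r},H_{i,r}$ ($i\in\mathbb{Z}/n\mathbb{Z}$, $r=0,1$) with relations, where $\{X,Y\}=XY+YX$, $\tilde H_{i,1}=H_{i,1}-\frac\hbar2H_{i,0}^2$, and $a_{i,i}=2$, $a_{i,i\pm1}=-1$, $a_{i,j}=0$ otherwise: $[H_{i,r},H_{j,s}]=0$; $[X^+_{i,0},X^-_{j,0}]=\delta_{i,j}H_{i,0}$; $[X^+_{i,1},X^-_{j,0}]=\delta_{i,j}H_{i,1}=[X^+_{i,0},X^-_{j,1}]$; $[H_{i,0},X^\pm_{j,r}]=\pm a_{i,j}X^\pm_{j,r}$; $[\tilde H_{i,1},X^\pm_{j,0}]=\pm a_{i,j}X^\pm_{j,1}$ if $(i,j)\ne(0,n-1),(n-1,0)$; $[\tilde H_{0,1},X^\pm_{n-1,0}]=\mp(X^\pm_{n-1,1}+(\varepsilon+\frac n2\hbar)X^\pm_{n-1,0})$; $[\tilde H_{n-1,1},X^\pm_{0,0}]=\mp(X^\pm_{0,1}-(\varepsilon+\frac n2\hbar)X^\pm_{0,0})$; $[X^\pm_{i,1},X^\pm_{j,0}]-[X^\pm_{i,0},X^\pm_{j,1}]=\pm a_{i,j}\frac\hbar2\{X^\pm_{i,0},X^\pm_{j,0}\}$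 if $(i,j)\ne(0,n-1),(n-1,0)$; $[X^\pm_{0,1},X^\pm_{n-1,0}]-[X^\pm_{0,0},X^\pm_{n-1,1}]=\mp\frac\hbar2\{X^\pm_{0,0},X^\pm_{n-1,0}\}+(\varepsilon+\frac n2\hbar)[X^\pm_{0,0},X^\pm_{n-1,0}]$; $(\mathrm{ad}X^\pm_{i,0})^{1+|a_{i,j}|}(X^\pm_{j,0})=0$ for $i\ne j$. It is generated by $X^\pm_{i,0}$ ($0\le i\le n-1$) and $H_{j,1}$ ($1\le j\le n-1$). **The homomorphisms $\Phi_a$.** $\Phi_a\colon Y_{\hbar,\varepsilon-(n_a-q_l)\hbar}(\widehat{\mathfrak{sl}}(n_a-n_{a+1}))\to\mathcal{U}(\mathcal{W}^k(\mathfrak{gl}(N),f))$ is the algebra homomorphism determined, with $d=n_1-n_a$ and $1\le i\le n_a-n_{a+1}-1$, by $X^+_{0,0}\mapsto W^{(1)}_{n_1-n_{a+1},d+1}t$, $X^-_{0,0}\mapsto W^{(1)}_{d+1,n_1-n_{a+1}}t^{-1}$, $X^+_{i,0}\mapsto W^{(1)}_{d+i,d+i+1}$, $X^-_{i,0}\mapsto W^{(1)}_{d+i+1,d+i}$, and $H_{i,1}\mapsto-\hbar(W^{(2)}_{d+i,d+i}t-W^{(2)}_{d+i+1,d+i+1}t)-\frac i2\hbar(W^{(1)}_{d+i,d+i}-W^{(1)}_{d+i+1,d+i+1})-\hbar W^{(1)}_{d+i,d+i}W^{(1)}_{d+i+1,d+i+1}+\hbar\sum_{s\ge0}\sum_{u=1}^iW^{(1)}_{d+i,d+u}t^{-s}W^{(1)}_{d+u,d+i}t^s+\hbar\sum_{s\ge0}\sum_{u=i+1}^{n_a-n_{a+1}}W^{(1)}_{d+i,d+u}t^{-s-1}W^{(1)}_{d+u,d+i}t^{s+1}-\hbar\sum_{s\ge0}\sum_{u=1}^iW^{(1)}_{d+i+1,d+u}t^{-s}W^{(1)}_{d+u,d+i+1}t^s-\hbar\sum_{s\ge0}\sum_{u=i+1}^{n_a-n_{a+1}}W^{(1)}_{d+i+1,d+u}t^{-s-1}W^{(1)}_{d+u,d+i+1}t^{s+1}$.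 *)

(* Defs.v *)
From HB Require Import structures.
From mathcomp Require Import all_boot all_order all_algebra.
From mathcomp Require Import generic_quotient boolp.
From mathcomp Require Import zify.

Set Implicit Arguments.
Unset Strict Implicit.
Unset Printing Implicit Defensive.

Import Order.TTheory GRing.Theory Num.Theory.
Local Open Scope ring_scope.
Local Open Scope quotient_scope.

Inductive span (F : pzRingType) (V : lmodType F) (S : V -> Prop) : V -> Prop :=
| span_nil : span S 0
| span_cons (c : F) (x y : V) of S x & span S y : span S (c *: x + y).

Section SpanTheory.
Variable F : pzRingType.
Implicit Types V U : lmodType F.

Lemma span_inc V (S : V -> Prop) x : S x -> span S x.
Proof. by move=> Sx; rewrite -[x]scale1r -[_ *: _]addr0; by apply: span_cons => //; apply: span_nil. Qed.

Lemma span_add V (S : V -> Prop) x y : span S x -> span S y -> span S (x + y).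
Proof.
move=> sx sy; elim: sx => [|c u v Su _ IH]; first by rewrite add0r.
by rewrite -addrA; constructor.
Qed.

Lemma span_scale V (S : V -> Prop) c x : span S x -> span S (c *: x).
Proof.
elim=> [|d u v Su _ IH]; first by rewrite scaler0; apply: span_nil.
by rewrite scalerDr scalerA; constructor.
Qed.

Lemma span_opp V (S : V -> Prop) x : span S x -> span S (- x).
Proof. by move=> sx; rewrite -scaleN1r; apply: span_scale. Qed.

Lemma span_sub V (S : V -> Prop) x y : span S x -> span S y -> span S (x - y).
Proof. by move=> sx sy; apply: span_add => //; apply: span_opp. Qed.

Lemma span_sum V (S : V -> Prop) I (r : seq I) (P : pred I) (f : I -> V) :
  (forall i, P i -> span S (f i)) -> span S (\sum_(i <- r | P i) f i).
Proof.
move=> Sf; elim/big_rec: _ => [|i x Pi sx]; first by constructor.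
by apply: span_add => //; apply: Sf.
Qed.

Lemma span_le V (S : V -> Prop) (T : V -> Prop) :
  T 0 -> (forall c x y, S x -> T y -> T (c *: x + y)) ->
  forall x, span S x -> T x.
Proof. by move=> T0 TD x; elim=> // c u v Su _; apply: TD. Qed.

Lemma span_mono V (S T : V -> Prop) :
  (forall x, S x -> T x) -> forall x, span S x -> span T x.
Proof. by move=> ST x; elim=> [|c u v Su _]; constructor => //; apply: ST. Qed.

Lemma span_map V U (f : V -> U) (S : V -> Prop) (T : U -> Prop) :
  (forall c x y, f (c *: x + y) = c *: f x + f y) ->
  (forall x, S x -> span T (f x)) -> forall x, span S x -> span T (f x).
Proof.
move=> fl fS x; elim=> [|c u v Su _ IH].
  have := fl 1 0 0; rewrite !scale1r addr0 => /(congr1 (fun t => t - f 0)).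
  by rewrite addrK subrr => <-; constructor.
by rewrite fl; apply: span_add => //; apply: span_scale; apply: fS.
Qed.

End SpanTheory.

(* MathComp algebras are required to be nonzero; an algebra given by generators
   and relations need not be, so the zero algebra is allowed here. *)

Record pzAlgType (F : pzRingType) := PzAlg {
  pz_ring : pzRingType;
  pz_scale : F -> pz_ring -> pz_ring;
  pz_scaleA : forall c d x, pz_scale c (pz_scale d x) = pz_scale (c * d) x;
  pz_scale1 : left_id 1 pz_scale;
  pz_scaleDr : right_distributive pz_scale +%R;
  pz_scaleDl : forall x, {morph pz_scale^~ x : c d / c + d};
  pz_scaleMl : forall c x y, pz_scale c (x * y) = pz_scale c x * y;
  pz_scaleMr : forall c x y, pz_scale c (x * y) = x * pz_scale c y
}.

Definition pz_sort (F : pzRingType) (A : pzAlgType F) : Type := pz_ring A.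
Coercion pz_sort : pzAlgType >-> Sortclass.
HB.instance Definition _ F (A : pzAlgType F) := GRing.PzRing.copy (pz_sort A) (pz_ring A).
HB.instance Definition _ F (A : pzAlgType F) :=
  GRing.Zmodule_isLmodule.Build F (pz_sort A)
    (@pz_scaleA F A) (@pz_scale1 F A) (@pz_scaleDr F A) (@pz_scaleDl F A).

Lemma pzalg_scaleAl F (A : pzAlgType F) c (x y : A) : c *: (x * y) = (c *: x) * y.
Proof. exact: pz_scaleMl. Qed.
Lemma pzalg_scaleAr F (A : pzAlgType F) c (x y : A) : c *: (x * y) = x * (c *: y).
Proof. exact: pz_scaleMr. Qed.

Definition alg_morphism (F : pzRingType) (A B : pzAlgType F) (f : A -> B) : Prop :=
  [/\ f 1 = 1, forall x y, f (x * y) = f x * f y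
    & forall (c : F) x y, f (c *: x + y) = c *: f x + f y].

Definition comm (A : pzRingType) (x y : A) : A := x * y - y * x.

(* A set of relations on generators [X] is a predicate [M] on maps from [X] to
   algebras; two expressions are identified when they agree in all algebras in
   which the relations hold. *)

Inductive aterm (F X : Type) :=
| AVar of X
| ACst of F
| AAdd of aterm F X & aterm F X
| AMul of aterm F X & aterm F X.

HB.instance Definition _ F X := gen_eqMixin (aterm F X).
HB.instance Definition _ F X := gen_choiceMixin (aterm F X).

Section PresentedAlgebra.
Variables (F : comNzRingType) (X : Type) (M : forall A : pzAlgType F, (X -> A) -> Prop).

Fixpoint aeval (A : pzAlgType F) (v : X -> A) (t : aterm F X) : A :=
  match t with
  | AVar x => v x
  | ACst c => c *: (1 : A)
  | AAdd s t => aeval v s + aeval v t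
  | AMul s t => aeval v s * aeval v t
  end.

Definition aequiv (s t : aterm F X) : bool :=
  `[< forall (A : pzAlgType F) (v : X -> A), M v -> aeval v s = aeval v t >].

Lemma aequiv_refl : reflexive aequiv. Proof. by move=> s; apply/asboolP. Qed.
Lemma aequiv_sym : symmetric aequiv.
Proof.
by move=> s t; apply/asboolP/asboolP => E A v m; rewrite (E A v m).
Qed.
Lemma aequiv_trans : transitive aequiv.
Proof.
move=> t s u /asboolP E /asboolP E'; apply/asboolP => A v m.
by rewrite (E A v m) (E' A v m).
Qed.

Definition aequiv_rel := EquivRel aequiv aequiv_refl aequiv_sym aequiv_trans.

Definition palg_sort := {eq_quot aequiv_rel}.
HB.instance Definition _ := Choice.on palg_sort.
HB.instance Definition _ := EqQuotient.on palg_sort.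

Definition pgen (x : X) : palg_sort := \pi_palg_sort (AVar F x).

(* Evaluation of an element of the presented algebra; it is an algebra morphism
   as soon as the relations [M v] hold. *)
Definition plift (A : pzAlgType F) (v : X -> A) (x : palg_sort) : A := aeval v (repr x).

Lemma palg_eq (x y : palg_sort) :
  (forall (A : pzAlgType F) (v : X -> A), M v -> plift v x = plift v y) -> x = y.
Proof.
move=> E; rewrite -[x]reprK -[y]reprK.
by apply/eqmodP/asboolP => A v m; apply: E.
Qed.

Lemma plift_pi (A : pzAlgType F) (v : X -> A) t : M v -> plift v (\pi_palg_sort t) = aeval v t.
Proof.
by move=> m; have /eqmodP/asboolP := reprK (\pi_palg_sort t : palg_sort); apply.
Qed.

Definition pzero : palg_sort := \pi_palg_sort (ACst X 0).
Definition pone : palg_sort := \pi_palg_sort (ACst X 1).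
Definition padd (x y : palg_sort) : palg_sort := \pi_palg_sort (AAdd (repr x) (repr y)).
Definition pmul (x y : palg_sort) : palg_sort := \pi_palg_sort (AMul (repr x) (repr y)).
Definition pscale (c : F) (x : palg_sort) : palg_sort := \pi_palg_sort (AMul (ACst X c) (repr x)).
Definition popp (x : palg_sort) : palg_sort := pscale (-1) x.

Section Model.
Variables (A : pzAlgType F) (v : X -> A).
Hypothesis m : M v.

Lemma plift0E : plift v pzero = 0.
Proof. by rewrite plift_pi //= scale0r. Qed.
Lemma plift1E : plift v pone = 1.
Proof. by rewrite plift_pi //= scale1r. Qed.
Lemma pliftDE x y : plift v (padd x y) = plift v x + plift v y.
Proof. by rewrite plift_pi. Qed.
Lemma pliftME x y : plift v (pmul x y) = plift v x * plift v y.
Proof. by rewrite plift_pi. Qed.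
Lemma pliftZE c x : plift v (pscale c x) = c *: plift v x.
Proof. by rewrite plift_pi //= -pzalg_scaleAl mul1r. Qed.
Lemma pliftNE x : plift v (popp x) = - plift v x.
Proof. by rewrite /popp pliftZE scaleN1r. Qed.

End Model.

Let pE := (plift0E, plift1E, pliftDE, pliftME, pliftZE, pliftNE).

Fact paddA : associative padd.
Proof. by move=> x y z; apply: palg_eq => A v m; rewrite !pE // addrA. Qed.
Fact paddC : commutative padd.
Proof. by move=> x y; apply: palg_eq => A v m; rewrite !pE // addrC. Qed.
Fact padd0 : left_id pzero padd.
Proof. by move=> x; apply: palg_eq => A v m; rewrite !pE // add0r. Qed.
Fact paddN : left_inverse pzero popp padd.
Proof. by move=> x; apply: palg_eq => A v m; rewrite !pE // addNr. Qed.
HB.instance Definition _ := GRing.isZmodule.Build palg_sort paddA paddC padd0 paddN.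

Fact pmulA : associative pmul.
Proof. by move=> x y z; apply: palg_eq => A v m; rewrite !pE // mulrA. Qed.
Fact pmul1 : left_id pone pmul.
Proof. by move=> x; apply: palg_eq => A v m; rewrite !pE // mul1r. Qed.
Fact pmulr1 : right_id pone pmul.
Proof. by move=> x; apply: palg_eq => A v m; rewrite !pE // mulr1. Qed.
Fact pmulDl : left_distributive pmul padd.
Proof. by move=> x y z; apply: palg_eq => A v m; rewrite !pE // mulrDl. Qed.
Fact pmulDr : right_distributive pmul padd.
Proof. by move=> x y z; apply: palg_eq => A v m; rewrite !pE // mulrDr. Qed.
HB.instance Definition _ :=
  GRing.Zmodule_isPzRing.Build palg_sort pmulA pmul1 pmulr1 pmulDl pmulDr.

Fact pscaleA c d x : pscale c (pscale d x) = pscale (c * d) x.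
Proof. by apply: palg_eq => A v m; rewrite !pE // scalerA. Qed.
Fact pscale1 : left_id 1 pscale.
Proof. by move=> x; apply: palg_eq => A v m; rewrite !pE // scale1r. Qed.
Fact pscaleDr : right_distributive pscale +%R.
Proof. by move=> c x y; apply: palg_eq => A v m; rewrite !pE // scalerDr. Qed.
Fact pscaleDl x : {morph pscale^~ x : c d / c + d}.
Proof. by move=> c d; apply: palg_eq => A v m; rewrite !pE // scalerDl. Qed.

Fact pscaleAl c x y : pscale c (x * y) = pscale c x * y.
Proof. by apply: palg_eq => A v m; rewrite !pE // pzalg_scaleAl. Qed.
Fact pscaleAr c x y : pscale c (x * y) = x * pscale c y.
Proof. by apply: palg_eq => A v m; rewrite !pE // pzalg_scaleAr. Qed.

Definition palg : pzAlgType F :=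
  PzAlg pscaleA pscale1 pscaleDr pscaleDl pscaleAl pscaleAr.

Lemma plift_morph (A : pzAlgType F) (v : X -> A) : M v -> alg_morphism (plift v : palg -> A).
Proof.
move=> m; split; first exact: plift1E.
  exact: pliftME.
by move=> c x y; rewrite pliftDE // pliftZE.
Qed.

Lemma plift_gen (A : pzAlgType F) (v : X -> A) x : M v -> plift v (pgen x) = v x.
Proof. by move=> m; rewrite plift_pi. Qed.

Lemma palg_ind (P : palg -> Prop) :
  (forall x, P (pgen x : palg)) -> (forall c, P (c *: (1 : palg))) ->
  (forall x y, P x -> P y -> P (x + y)) -> (forall x y, P x -> P y -> P (x * y)) ->
  forall x, P x.
Proof.
move=> Pg Pc PD PM x; rewrite -[x]reprK; elim: (repr x) => {x} [x|c|s IHs t IHt|s IHs t IHt].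
- exact: Pg.
- suff -> : \pi_palg_sort (ACst X c) = pscale c pone by exact: Pc.
  by apply: palg_eq => A v m; rewrite pliftZE // plift1E // plift_pi.
- suff -> : \pi_palg_sort (AAdd s t) = padd (\pi_palg_sort s) (\pi_palg_sort t) by exact: PD.
  by apply: palg_eq => A v m; rewrite pliftDE // !plift_pi.
suff -> : \pi_palg_sort (AMul s t) = pmul (\pi_palg_sort s) (\pi_palg_sort t) by exact: PM.
by apply: palg_eq => A v m; rewrite pliftME // !plift_pi.
Qed.

End PresentedAlgebra.

Definition gbin (F : fieldType) (m : int) (j : nat) : F :=
  (\prod_(i < j) (m - i%:Z)%:~R) / (j`!)%:R.

Section VertexAxioms.
Variables (F : numFieldType) (V : lmodType F).
(* [prd n u v] is the product u_(n) v; [hom d p] is the space of vectors of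
   conformal weight [d] and parity [p] (true = odd). *)
Variables (vac : V) (prd : int -> V -> V -> V) (hom : int -> bool -> V -> Prop).

Record vertex_axioms : Prop := {
  va_linl : forall n c u u' v, prd n (c *: u + u') v = c *: prd n u v + prd n u' v;
  va_linr : forall n c u v v', prd n u (c *: v + v') = c *: prd n u v + prd n u v';
  va_hom0 : forall d p, hom d p 0;
  va_homD : forall d p c u v, hom d p u -> hom d p v -> hom d p (c *: u + v);
  va_hom_neg : forall d p u, d < 0 -> hom d p u -> u = 0;
  va_hom_span : forall u, span (fun v => exists d p, hom d p v) u;
  va_hom_direct : forall (ks : seq (int * bool)) (f : int * bool -> V),
    uniq ks -> (forall x, hom x.1 x.2 (f x)) -> \sum_(x <- ks) f x = 0 ->
    forall x, x \in ks -> f x = 0;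
  va_hom_vac : hom 0 false vac;
  va_hom_prd : forall d p e r n u v, hom d p u -> hom e r v ->
    hom (d + e - n - 1) (p (+) r) (prd n u v);
  va_vacl : forall n u, prd n vac u = if n == -1 then u else 0;
  va_vacr : forall u, prd (-1) u vac = u;
  va_vacr0 : forall n u, 0 <= n -> prd n u vac = 0;
  (* Borcherds' identity; the sums, infinite but with finitely many nonzero
     terms, are cut at any [M] beyond which all their terms vanish. *)
  va_borcherds : forall d p a e r b c (l m n : int) (M : nat),
    hom d p a -> hom e r b ->
    (forall j : nat, (M <= j)%N ->
       [/\ prd (l + j%:Z) a b = 0, prd (n + j%:Z) b c = 0 & prd (m + j%:Z) a c = 0]) ->
    \sum_(j < M) gbin F m j *: prd (m + n - j%:Z) (prd (l + j%:Z) a b) c =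
    \sum_(j < M) ((-1) ^+ j * gbin F l j) *:
      (prd (m + l - j%:Z) a (prd (n + j%:Z) b c)
       - ((-1) ^ l * (-1) ^+ (p && r)) *: prd (n + l - j%:Z) b (prd (m + j%:Z) a c))
}.
End VertexAxioms.

Record vsalg (F : numFieldType) := VSAlg {
  vs_lmod : lmodType F;
  vac : vs_lmod;
  prd : int -> vs_lmod -> vs_lmod -> vs_lmod;
  hom : int -> bool -> vs_lmod -> Prop;
  vs_axioms : vertex_axioms vac prd hom
}.
Coercion vs_lmod : vsalg >-> lmodType.
Arguments vac {F v}.
Arguments prd {F v}.
Arguments hom {F v}.

Record valg (F : numFieldType) := VAlg {
  va_vs :> vsalg F;
  va_even : forall d (u : va_vs), hom d true u -> u = 0
}.

Section VertexTheory.
Variables (F : numFieldType) (V : vsalg F).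
Let ax := vs_axioms V.
Implicit Types u v w : V.

Lemma prd0l n v : prd n (0 : V) v = 0.
Proof.
have := va_linl ax n 1 0 0 v; rewrite !scale1r addr0.
by move/(congr1 (fun t => t - prd n 0 v)); rewrite addrK subrr.
Qed.
Lemma prd0r n v : prd n v (0 : V) = 0.
Proof.
have := va_linr ax n 1 v 0 0; rewrite !scale1r addr0.
by move/(congr1 (fun t => t - prd n v 0)); rewrite addrK subrr.
Qed.
Lemma prdZl n c u v : prd n (c *: u) v = c *: prd n u v.
Proof. by rewrite -[c *: u]addr0 (va_linl ax) prd0l addr0. Qed.
Lemma prdZr n c u v : prd n u (c *: v) = c *: prd n u v.
Proof. by rewrite -[c *: v]addr0 (va_linr ax) prd0r addr0. Qed.
Lemma prdDl n u u' v : prd n (u + u') v = prd n u v + prd n u' v.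
Proof. by rewrite -[u]scale1r (va_linl ax) !scale1r. Qed.
Lemma prdDr n u v v' : prd n u (v + v') = prd n u v + prd n u v'.
Proof. by rewrite -[v]scale1r (va_linr ax) !scale1r. Qed.
Lemma prd_suml n I (r : seq I) (P : pred I) (f : I -> V) v :
  prd n (\sum_(i <- r | P i) f i) v = \sum_(i <- r | P i) prd n (f i) v.
Proof. by apply: (big_morph (fun t => prd n t v)) => [x y|]; rewrite ?prdDl ?prd0l. Qed.
Lemma prd_sumr n I (r : seq I) (P : pred I) (f : I -> V) v :
  prd n v (\sum_(i <- r | P i) f i) = \sum_(i <- r | P i) prd n v (f i).
Proof. by apply: (big_morph (prd n v)) => [x y|]; rewrite ?prdDr ?prd0r. Qed.

Lemma homZ d p c u : hom d p u -> hom d p (c *: u).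
Proof. by move=> hu; rewrite -[c *: u]addr0; apply: (va_homD ax) => //; apply: (va_hom0 ax). Qed.
Lemma homD d p u v : hom d p u -> hom d p v -> hom d p (u + v).
Proof. by move=> hu hv; rewrite -[u]scale1r; apply: (va_homD ax). Qed.
Lemma hom_sum d p I (r : seq I) (P : pred I) (f : I -> V) :
  (forall i, P i -> hom d p (f i)) -> hom d p (\sum_(i <- r | P i) f i).
Proof.
move=> hf; elim/big_rec: _ => [|i x Pi hx]; first exact: (va_hom0 ax).
by apply: homD => //; apply: hf.
Qed.

Lemma prd_trunc u v : exists N : int, forall n, N <= n -> prd n u v = 0.
Proof.
elim: (va_hom_span ax u) => [|c x y [d [p hx]] _ [N IH]].
  by exists 0 => n _; rewrite prd0l.
suff [N' HN'] : exists N' : int, forall n, N' <= n -> prd n x v = 0 :> V.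
  exists (Num.max N N') => n; rewrite ge_max => /andP[h h'].
  by rewrite (va_linl ax) IH // HN' // scaler0 addr0.
elim: (va_hom_span ax v) => [|c' x' y' [e [r hx']] _ [N' IH']].
  by exists 0 => n _; rewrite prd0r.
exists (Num.max N' (d + e)) => n; rewrite ge_max => /andP[h h'].
rewrite (va_linr ax) IH' // addr0; have /(va_hom_neg ax) := va_hom_prd ax n hx hx'.
by move=> ->; rewrite ?scaler0 //; lia.
Qed.

Lemma hom_dec u : exists (ks : seq (int * bool)) (f : int * bool -> V),
  [/\ uniq ks, forall x, hom x.1 x.2 (f x) & u = \sum_(x <- ks) f x].
Proof.
have [r [hr ->]] : exists r : seq ((int * bool) * V),
    (forall z, z \in r -> hom z.1.1 z.1.2 z.2) /\ u = \sum_(z <- r) z.2.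
  elim: (va_hom_span ax u) => [|c x y [d [p hx]] _ [r [hr ->]]].
    by exists [::]; split=> //; rewrite big_nil.
  exists (((d, p), c *: x) :: r); split; last by rewrite big_cons.
  by move=> z; rewrite inE => /predU1P[->|/hr //]; apply: homZ.
exists (undup (map fst r)), (fun x => \sum_(z <- r | z.1 == x) z.2).
split; first exact: undup_uniq.
  move=> x; rewrite big_seq_cond; apply: hom_sum => z /andP[zr /eqP <-]; exact: hr.
rewrite (exchange_big_dep predT) //= big_seq [RHS]big_seq; apply: eq_bigr => z zr.
rewrite (eq_bigl (pred1 z.1)) => [|x]; last by rewrite eq_sym.
rewrite -big_filter filter_pred1_uniq ?undup_uniq ?big_seq1 //.
by rewrite mem_undup; apply: map_f.
Qed.

Lemma gbin0 j : gbin F 0 j = (j == 0%N)%:R.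
Proof.
case: j => [|j]; rewrite /gbin; first by rewrite big_ord0 fact0 divr1.
by rewrite big_ord_recl /= mul0r mul0r.
Qed.

Lemma prd0_comm d p e r (a b c : V) (n : int) : hom d p a -> hom e r b ->
  prd 0 a (prd n b c) = prd n (prd 0 a b) c + (-1) ^+ (p && r) *: prd n b (prd 0 a c).
Proof.
move=> ha hb.
have [N1 H1] := prd_trunc a b; have [N2 H2] := prd_trunc b c; have [N3 H3] := prd_trunc a c.
pose M := (`|N1| + `|N2| + `|N3| + `|n|).+1%N.
have := va_borcherds ax (l := 0) (m := 0) (n := n) (M := M) (c := c) ha hb.
have tail0 (f : nat -> V) (g : nat -> F) : g 0%N = 1 -> (forall j, g j.+1 = 0) ->
    \sum_(j < M) g j *: f j = f 0%N.
  move=> g0 gS; rewrite big_ord_recl g0 scale1r big1 ?addr0 // => i _.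
  by rewrite gS scale0r.
rewrite (tail0 (fun j => prd (0 + n - j%:Z) (prd (0 + j%:Z) a b) c) (gbin F 0)).
- rewrite (tail0 (fun j => prd (0 + 0 - j%:Z) a (prd (n + j%:Z) b c) -
    ((-1) ^ (0 : int) * (-1) ^+ (p && r)) *: prd (n + 0 - j%:Z) b (prd (0 + j%:Z) a c))
    (fun j => (-1) ^+ j * gbin F 0 j)) ?gbin0 ?mulr1 //; last by move=> j; rewrite gbin0 mulr0.
  rewrite -[Posz 0]/(0 : int) !(addr0, subr0, add0r) expr0z mul1r => -> ; first by rewrite subrK.
  by move=> j hj; split; [apply: H1|apply: H2|apply: H3]; lia.
- by rewrite gbin0.
by move=> j; rewrite gbin0.
Qed.

End VertexTheory.

Record va_morphism (F : numFieldType) (V W : vsalg F) (f : V -> W) : Prop := {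
  vm_lin : forall c u v, f (c *: u + v) = c *: f u + f v;
  vm_vac : f vac = vac;
  vm_prd : forall n u v, f (prd n u v) = prd n (f u) (f v);
  vm_hom : forall d p u, hom d p u -> hom d p (f u)
}.

Section SubVertexAlgebra.
Variables (F : numFieldType) (V : vsalg F).
Let ax := vs_axioms V.

Record is_subva (S : V -> Prop) : Prop := {
  sv_vac : S vac;
  sv_lin : forall c u v, S u -> S v -> S (c *: u + v);
  sv_prd : forall n u v, S u -> S v -> S (prd n u v);
  sv_graded : forall u, S u -> span (fun v => S v /\ exists d p, hom d p v) u
}.

Variables (S : V -> Prop) (HS : is_subva S).

Definition subva_pred of is_subva S : pred V := fun u => `[< S u >].

Fact subva_submod : GRing.submod_closed (subva_pred HS).
Proof.
split=> [|c u v /asboolP Su /asboolP Sv]; apply/asboolP; last exact: (sv_lin HS).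
by rewrite -(addNr vac) -scaleN1r; apply: (sv_lin HS); apply: (sv_vac HS).
Qed.
HB.instance Definition _ := GRing.isSubmodClosed.Build F V (subva_pred HS) subva_submod.

Definition subva_sort := {u : V | u \in subva_pred HS}.
HB.instance Definition _ := Choice.on subva_sort.
HB.instance Definition _ := [isSub of subva_sort for @sval V _].
HB.instance Definition _ := [SubChoice_isSubLmodule of subva_sort by <:].

Lemma subvaP (x : subva_sort) : S (val x).
Proof. by apply/asboolP; apply: (valP x). Qed.

Definition to_subva u (Su : S u) : subva_sort := exist _ u (introT (asboolP (S u)) Su).

Definition subva_vac : subva_sort := to_subva (sv_vac HS).
Definition subva_prd n (x y : subva_sort) : subva_sort :=
  to_subva (sv_prd HS n (subvaP x) (subvaP y)).
Definition subva_hom d p (x : subva_sort) : Prop := hom d p (val x).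

Lemma subva_valD c (x y : subva_sort) : val (c *: x + y) = c *: val x + val y.
Proof. by []. Qed.

Fact subva_axioms : vertex_axioms subva_vac subva_prd subva_hom.
Proof.
split.
- by move=> n c u u' v; apply: val_inj; apply: (va_linl ax).
- by move=> n c u v v'; apply: val_inj; apply: (va_linr ax).
- by move=> d p; apply: (va_hom0 ax).
- by move=> d p c u v; apply: (va_homD ax).
- by move=> d p u d0 /(va_hom_neg ax d0) u0; apply: val_inj.
- move=> u; have: forall y, span (fun v => S v /\ exists d p, hom d p v) y ->
      exists2 x, val x = y & span (fun v => exists d p, subva_hom d p v) x.
    move=> y; elim=> [|c z t [Sz hz] _ [x <- sx]]; first by exists 0 => //; constructor.
    by exists (c *: to_subva Sz + x) => //; constructor.
  by case/(_ _ (sv_graded HS (subvaP u))) => x /val_inj ->.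
- move=> ks f uks hf s0 x xks; apply: val_inj.
  apply: (va_hom_direct ax (ks := ks) (f := fun y => val (f y))) => //.
  by rewrite -raddf_sum s0.
- exact: (va_hom_vac ax).
- by move=> d p e r n u v; apply: (va_hom_prd ax).
- by move=> n u; apply: val_inj; rewrite /= (va_vacl ax); case: ifP.
- by move=> u; apply: val_inj; apply: (va_vacr ax).
- by move=> n u n0; apply: val_inj; apply: (va_vacr0 ax).
move=> d p a e r b c l m n M ha hb HM; apply: val_inj.
rewrite !raddf_sum /=; apply: (va_borcherds ax ha hb) => j /HM[h1 h2 h3].
by split; [exact: (congr1 val h1)|exact: (congr1 val h2)|exact: (congr1 val h3)].
Qed.

Definition subva : vsalg F := VSAlg subva_axioms.

Lemma subva_incl : va_morphism (val : subva -> V).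
Proof. by split. Qed.

End SubVertexAlgebra.

Definition subvalg (F : numFieldType) (V : valg F) (S : V -> Prop) (HS : is_subva S) : valg F.
Proof.
by exists (subva HS) => d u hu; apply: val_inj; apply: (va_even (hu : hom d true (val u))).
Defined.

Inductive vgen (F : numFieldType) (V : vsalg F) (S : V -> Prop) : V -> Prop :=
| vgen_gen u of S u : vgen S u
| vgen_vac : vgen S vac
| vgen_lin c u v of vgen S u & vgen S v : vgen S (c *: u + v)
| vgen_prd n u v of vgen S u & vgen S v : vgen S (prd n u v).

Lemma vgen_subva (F : numFieldType) (V : vsalg F) (S : V -> Prop) :
  (forall u, S u -> exists d p, hom d p u) -> is_subva (vgen S).
Proof.
have ax := vs_axioms V.
move=> hS; split; [exact: vgen_vac|by move=> *; apply: vgen_lin|by move=> *; apply: vgen_prd|].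
move=> u; elim=> {u} [u Su||c u v _ su _ sv|n u v _ su _ sv].
- by apply: span_inc; split; [apply: vgen_gen|apply: hS].
- apply: span_inc; split; first exact: vgen_vac.
  by exists 0, false; apply: (va_hom_vac ax).
- by apply: span_add => //; apply: span_scale.
move: su; apply: (span_map (f := fun t => prd n t v)).
  by move=> c x y; rewrite (va_linl ax).
move=> x [gx [d [p hx]]]; move: sv; apply: (span_map (f := fun t => prd n x t)).
  by move=> c y z; rewrite (va_linr ax).
move=> y [gy [e [r hy]]]; apply: span_inc; split; first exact: vgen_prd.
by exists (d + e - n - 1), (p (+) r); apply: (va_hom_prd ax).
Qed.

Definition coset_set (F : numFieldType) (V : vsalg F) (B : V -> Prop) (v : V) : Prop :=
  forall (w : V) (r : nat), B w -> prd r%:Z w v = 0.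

Lemma coset_subva (F : numFieldType) (V : valg F) (B : V -> Prop) :
  is_subva B -> is_subva (coset_set B).
Proof.
move=> HB; have ax := vs_axioms V.
have gr u : coset_set B u -> exists (ks : seq (int * bool)) (f : int * bool -> V),
  [/\ forall x, hom x.1 x.2 (f x), forall x, x \in ks -> coset_set B (f x)
    & u = \sum_(x <- ks) f x].
  move=> cu; have [ks [f [uks hf eu]]] := hom_dec u; exists ks, f; split=> // x xks w r Bw.
  have [] // : prd r%:Z w (f x) = 0.
  elim: (sv_graded HB Bw) => [|c w1 w2 [Bw1 [d [p hw1]]] _ IH]; first by rewrite prd0l.
  rewrite (va_linl ax) IH addr0.
  suff -> : prd r%:Z w1 (f x) = 0 by rewrite scaler0.
  pose sh (z : int * bool) := (d + z.1 - r%:Z - 1, p (+) z.2).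
  pose un (z : int * bool) := (z.1 - d + r%:Z + 1, p (+) z.2).
  have shK : cancel sh un.
    by case=> z q; rewrite /sh /un /= addbA addbb addFb; congr (_, _); lia.
  have unK : cancel un sh.
    by case=> z q; rewrite /sh /un /= addbA addbb addFb; congr (_, _); lia.
  have := va_hom_direct ax (ks := map sh ks) (f := fun z => prd r%:Z w1 (f (un z))).
  move=> /(_ _ _ _ (sh x)); rewrite shK; apply.
  - by rewrite map_inj_uniq //; apply: can_inj shK.
  - move=> z; rewrite -{1 2}[z]unK; exact: (va_hom_prd ax).
  - rewrite big_map (eq_bigr (fun z => prd r%:Z w1 (f z))) => [|z _]; last by rewrite shK.
    by rewrite -prd_sumr -eu; apply: cu.
  by apply: map_f.
split.
- by move=> w r _; apply: (va_vacr0 ax).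
- by move=> c u v cu cv w r Bw; rewrite (va_linr ax) cu // cv // scaler0 addr0.
- move=> n u v /gr[ks [f [hf cf ->]]] cv w r Bw.
  rewrite prd_suml prd_sumr big_seq big1 // => x xks.
  elim: (sv_graded HB Bw) => [|c w1 w2 [Bw1 [d [p hw1]]] _ IH]; first by rewrite prd0l.
  rewrite (va_linl ax) IH addr0.
  suff -> : prd r%:Z w1 (prd n (f x) v) = 0 by rewrite scaler0.
  have [N1 H1] := prd_trunc (f x) v.
  pose M := (`|N1| + `|n|).+1%N.
  have := va_borcherds ax (l := 0) (m := r%:Z) (n := n) (M := M) (c := v) hw1 (hf x).
  rewrite big1 => [|j _]; last by rewrite add0r cf // prd0l scaler0.
  rewrite big_ord_recl /= gbin0 mul1r scale1r big1 => [|j _]; last first.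
    by rewrite gbin0 mulr0 scale0r.
  rewrite -[Posz 0]/(0 : int) !(addr0, subr0, add0r) cv // prd0r scaler0 subr0 => <- // j hj.
  by split; [rewrite add0r; apply: cf|apply: H1; lia|rewrite -PoszD; apply: cv].
move=> u /gr[ks [f [hf cf ->]]]; rewrite big_seq; apply: span_sum => x xks.
by apply: span_inc; split; [apply: cf|exists x.1, x.2].
Qed.

Definition coset (F : numFieldType) (V : valg F) (B : V -> Prop) (HB : is_subva B) : valg F :=
  subvalg (coset_subva HB).

(* Generators [x] have a conformal weight and a parity, and for [n >= 0] the
   product x_(n) y of two generators is prescribed by [ope n x y].  The universal
   vertex superalgebra identifies two expressions in the generators when they
   agree in every vertex superalgebra with fields obeying these relations. *)

Inductive vterm (F X : Type) :=
| VGen of X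
| VVac
| VPrd of int & vterm F X & vterm F X
| VLin of F & vterm F X & vterm F X  (* c *: s + t *)
| VZero.

HB.instance Definition _ F X := gen_eqMixin (vterm F X).
HB.instance Definition _ F X := gen_choiceMixin (vterm F X).

Fixpoint veval (F : numFieldType) (X : Type) (V : vsalg F) (v : X -> V) (t : vterm F X) : V :=
  match t with
  | VGen x => v x
  | VVac => vac
  | VPrd n s t => prd n (veval v s) (veval v t)
  | VLin c s t => c *: veval v s + veval v t
  | VZero => 0
  end.

Record ope_data (F : numFieldType) := OPEData {
  og :> Type;
  owt : og -> int;
  opar : og -> bool;
  ope : nat -> og -> og -> vterm F og
}.

Record ope_model (F : numFieldType) (D : ope_data F) (V : vsalg F) (v : D -> V) : Prop := {
  om_hom : forall x, hom (owt x) (opar x) (v x);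
  om_ope : forall (n : nat) x y, prd n%:Z (v x) (v y) = veval v (ope n x y)
}.

Section Universal.
Variables (F : numFieldType) (D : ope_data F).

Definition vequiv (s t : vterm F D) : bool :=
  `[< forall (V : vsalg F) (v : D -> V), ope_model v -> veval v s = veval v t >].

Lemma vequiv_refl : reflexive vequiv. Proof. by move=> s; apply/asboolP. Qed.
Lemma vequiv_sym : symmetric vequiv.
Proof. by move=> s t; apply/asboolP/asboolP => E V v m; rewrite (E V v m). Qed.
Lemma vequiv_trans : transitive vequiv.
Proof.
move=> t s u /asboolP E /asboolP E'; apply/asboolP => V v m.
by rewrite (E V v m) (E' V v m).
Qed.

Definition vequiv_rel := EquivRel vequiv vequiv_refl vequiv_sym vequiv_trans.

Definition vuniv_sort := {eq_quot vequiv_rel}.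
HB.instance Definition _ := Choice.on vuniv_sort.
HB.instance Definition _ := EqQuotient.on vuniv_sort.

Definition vlift (V : vsalg F) (v : D -> V) (x : vuniv_sort) : V := veval v (repr x).

Lemma vuniv_eq (x y : vuniv_sort) :
  (forall (V : vsalg F) (v : D -> V), ope_model v -> vlift v x = vlift v y) -> x = y.
Proof.
move=> E; rewrite -[x]reprK -[y]reprK.
by apply/eqmodP/asboolP => V v m; apply: E.
Qed.

Lemma vlift_pi (V : vsalg F) (v : D -> V) t :
  ope_model v -> vlift v (\pi_vuniv_sort t) = veval v t.
Proof. by move=> m; have /eqmodP/asboolP := reprK (\pi_vuniv_sort t); apply. Qed.

Definition uzero : vuniv_sort := \pi_vuniv_sort (VZero F D).
Definition ulin c (x y : vuniv_sort) := \pi_vuniv_sort (VLin c (repr x) (repr y)).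
Definition uadd := ulin 1.
Definition uscale c x := ulin c x uzero.
Definition uopp := uscale (-1).
Definition uvac : vuniv_sort := \pi_vuniv_sort (VVac F D).
Definition uprd n (x y : vuniv_sort) := \pi_vuniv_sort (VPrd n (repr x) (repr y)).

Section Model.
Variables (V : vsalg F) (v : D -> V).
Hypothesis m : ope_model v.

Lemma vlift0E : vlift v uzero = 0.
Proof. by rewrite vlift_pi. Qed.
Lemma vliftlE c x y : vlift v (ulin c x y) = c *: vlift v x + vlift v y.
Proof. by rewrite vlift_pi. Qed.
Lemma vliftDE x y : vlift v (uadd x y) = vlift v x + vlift v y.
Proof. by rewrite vliftlE scale1r. Qed.
Lemma vliftZE c x : vlift v (uscale c x) = c *: vlift v x.
Proof. by rewrite vliftlE vlift0E addr0. Qed.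
Lemma vliftNE x : vlift v (uopp x) = - vlift v x.
Proof. by rewrite vliftZE scaleN1r. Qed.
Lemma vliftvE : vlift v uvac = vac.
Proof. by rewrite vlift_pi. Qed.
Lemma vliftPE n x y : vlift v (uprd n x y) = prd n (vlift v x) (vlift v y).
Proof. by rewrite vlift_pi. Qed.

End Model.

Let uE := (vlift0E, vliftDE, vliftZE, vliftNE, vliftvE, vliftPE).

Fact uaddA : associative uadd.
Proof. by move=> x y z; apply: vuniv_eq => V v m; rewrite !uE // addrA. Qed.
Fact uaddC : commutative uadd.
Proof. by move=> x y; apply: vuniv_eq => V v m; rewrite !uE // addrC. Qed.
Fact uadd0 : left_id uzero uadd.
Proof. by move=> x; apply: vuniv_eq => V v m; rewrite !uE // add0r. Qed.
Fact uaddN : left_inverse uzero uopp uadd.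
Proof. by move=> x; apply: vuniv_eq => V v m; rewrite !uE // addNr. Qed.
HB.instance Definition _ := GRing.isZmodule.Build vuniv_sort uaddA uaddC uadd0 uaddN.

Fact uscaleA c d x : uscale c (uscale d x) = uscale (c * d) x.
Proof. by apply: vuniv_eq => V v m; rewrite !uE // scalerA. Qed.
Fact uscale1 : left_id 1 uscale.
Proof. by move=> x; apply: vuniv_eq => V v m; rewrite !uE // scale1r. Qed.
Fact uscaleDr : right_distributive uscale +%R.
Proof. by move=> c x y; apply: vuniv_eq => V v m; rewrite !uE // scalerDr. Qed.
Fact uscaleDl x : {morph uscale^~ x : c d / c + d}.
Proof. by move=> c d; apply: vuniv_eq => V v m; rewrite !uE // scalerDl. Qed.
HB.instance Definition _ :=
  GRing.Zmodule_isLmodule.Build F vuniv_sort uscaleA uscale1 uscaleDr uscaleDl.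

Lemma vlift_lin (V : vsalg F) (v : D -> V) c (x y : vuniv_sort) :
  ope_model v -> vlift v (c *: x + y) = c *: vlift v x + vlift v y.
Proof. by move=> m; rewrite vliftDE // vliftZE. Qed.

Lemma vlift_sum (V : vsalg F) (v : D -> V) I (r : seq I) (P : pred I) (f : I -> vuniv_sort) :
  ope_model v -> vlift v (\sum_(i <- r | P i) f i) = \sum_(i <- r | P i) vlift v (f i).
Proof. by move=> m; apply: big_morph => [x y|]; rewrite ?vliftDE ?vlift0E. Qed.

Inductive thom : int -> bool -> vterm F D -> Prop :=
| thom_gen x : thom (owt x) (opar x) (VGen F x)
| thom_vac : thom 0 false (VVac F D)
| thom_prd d p e r n s t of thom d p s & thom e r t :
    thom (d + e - n - 1) (p (+) r) (VPrd n s t)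
| thom_lin d p c s t of thom d p s & thom d p t : thom d p (VLin c s t)
| thom_zero d p : thom d p (VZero F D).

Lemma thom_hom (V : vsalg F) (v : D -> V) d p t :
  ope_model v -> thom d p t -> hom d p (veval v t).
Proof.
move=> m; have ax := vs_axioms V.
elim=> {d p t} [x||d p e r n s t _ hs _ ht|d p c s t _ hs _ ht|d p] /=.
- exact: om_hom m x.
- exact: va_hom_vac ax.
- exact: (va_hom_prd ax).
- exact: (va_homD ax).
exact: (va_hom0 ax).
Qed.

Definition uhom d p (x : vuniv_sort) : Prop := exists2 t, thom d p t & x = \pi_vuniv_sort t.

Lemma uhom_lift (V : vsalg F) (v : D -> V) d p x :
  ope_model v -> uhom d p x -> hom d p (vlift v x).
Proof. by move=> m [t ht ->]; rewrite vlift_pi //; apply: thom_hom. Qed.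

Fact uhom_span x : span (fun y => exists d p, uhom d p y) x.
Proof.
rewrite -[x]reprK; elim: (repr x) => {x} [x||n s hs t ht|c s hs t ht|].
- by apply: span_inc; exists (owt x), (opar x), (VGen F x) => //; constructor.
- by apply: span_inc; exists 0, false, (VVac F D) => //; constructor.
- suff -> : \pi_vuniv_sort (VPrd n s t) = uprd n (\pi_vuniv_sort s) (\pi_vuniv_sort t).
    move: hs; apply: (span_map (f := fun y => uprd n y _)) => [c y z|y [d [p hy]]].
      by apply: vuniv_eq => V v m; rewrite !uE // (va_linl (vs_axioms V)).
    move: ht; apply: (span_map (f := fun z => uprd n y z)) => [c z z'|z [e [r hz]]].
      by apply: vuniv_eq => V v m; rewrite !uE // (va_linr (vs_axioms V)).
    case: hy hz => s' hs' -> [t' ht' ->]; apply: span_inc.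
    exists (d + e - n - 1), (p (+) r), (VPrd n s' t'); first by constructor.
    by apply: vuniv_eq => V v m; rewrite !uE // !vlift_pi.
  by apply: vuniv_eq => V v m; rewrite !uE // !vlift_pi.
- suff -> : \pi_vuniv_sort (VLin c s t) = c *: \pi_vuniv_sort s + \pi_vuniv_sort t.
    by apply: span_add => //; apply: span_scale.
  by apply: vuniv_eq => V v m; rewrite vlift_lin // !vlift_pi.
exact: span_nil.
Qed.

Fact vuniv_axioms : vertex_axioms uvac uprd uhom.
Proof.
split.
- move=> n c x x' y; apply: vuniv_eq => V v m.
  by rewrite !(vlift_lin, uE) // (va_linl (vs_axioms V)).
- move=> n c x y y'; apply: vuniv_eq => V v m.
  by rewrite !(vlift_lin, uE) // (va_linr (vs_axioms V)).
- by move=> d p; exists (VZero F D) => //; constructor.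
- move=> d p c x y [s hs ->] [t ht ->]; exists (VLin c s t); first by constructor.
  by apply: vuniv_eq => V v m; rewrite vlift_lin // !vlift_pi.
- move=> d p x d0 hx; apply: vuniv_eq => V v m; rewrite vlift0E //.
  exact: (va_hom_neg (vs_axioms V) d0 (uhom_lift m hx)).
- exact: uhom_span.
- move=> ks f uks hf s0 x xks; apply: vuniv_eq => V v m; rewrite vlift0E //.
  apply: (va_hom_direct (vs_axioms V) (ks := ks) (f := fun y => vlift v (f y))) => //.
    by move=> y; apply: uhom_lift.
  by rewrite -vlift_sum // s0 vlift0E.
- by exists (VVac F D) => //; constructor.
- move=> d p e r n x y [s hs ->] [t ht ->]; exists (VPrd n s t); first by constructor.
  by apply: vuniv_eq => V v m; rewrite !uE // !vlift_pi.
- move=> n x; apply: vuniv_eq => V v m; rewrite !uE // (va_vacl (vs_axioms V)).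
  by case: ifP; rewrite ?vlift0E.
- by move=> x; apply: vuniv_eq => V v m; rewrite !uE // (va_vacr (vs_axioms V)).
- by move=> n x n0; apply: vuniv_eq => V v m; rewrite !uE // (va_vacr0 (vs_axioms V)).
move=> d p a e r b c l m n M ha hb HM; apply: vuniv_eq => V v mv.
have lz k x : vlift v (k *: x) = k *: vlift v x by exact: vliftZE.
have lb x y : vlift v (x - y) = vlift v x - vlift v y.
  by rewrite -[LHS]/(vlift v (uadd x (uopp y))) !uE.
rewrite !vlift_sum //.
under eq_bigr do rewrite lz !uE //.
under [RHS]eq_bigr do rewrite lz lb lz !uE //.
apply: (va_borcherds (vs_axioms V) (uhom_lift mv ha) (uhom_lift mv hb)) => j /HM[h1 h2 h3].
by rewrite -!(vliftPE mv) h1 h2 h3 !vlift0E.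
Qed.

Definition vuniv : vsalg F := VSAlg vuniv_axioms.

Definition ugen (x : D) : vuniv := \pi_vuniv_sort (VGen F x).

Lemma veval_ugen t : veval ugen t = \pi_vuniv_sort t :> vuniv.
Proof.
apply: vuniv_eq => V v m; rewrite vlift_pi //.
elim: t => [x||n s IHs t IHt|c s IHs t IHt|] /=.
- by rewrite vlift_pi.
- exact: vliftvE.
- by rewrite vliftPE // IHs IHt.
- by rewrite vlift_lin // IHs IHt.
exact: vlift0E.
Qed.

Lemma ugen_model : ope_model ugen.
Proof.
split=> [x|n x y]; first by exists (VGen F x) => //; constructor.
rewrite veval_ugen; apply: vuniv_eq => V v m.
by rewrite vliftPE // !vlift_pi //= (om_ope m).
Qed.

Lemma vlift_morphism (V : vsalg F) (v : D -> V) :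
  ope_model v -> va_morphism (vlift v : vuniv -> V).
Proof.
move=> m; split=> [c x y||n x y|d p x]; first exact: vlift_lin.
- exact: vliftvE.
- exact: vliftPE.
exact: uhom_lift.
Qed.

Lemma vlift_ugen (V : vsalg F) (v : D -> V) x : ope_model v -> vlift v (ugen x) = v x.
Proof. by move=> m; rewrite vlift_pi. Qed.

Lemma vlift_unique (V : vsalg F) (v : D -> V) (f : vuniv -> V) :
  ope_model v -> va_morphism f -> (forall x, f (ugen x) = v x) -> forall x, f x = vlift v x.
Proof.
move=> m mf fg x; rewrite /vlift -[in LHS](reprK x) -veval_ugen.
have f0 : f 0 = 0.
  have := vm_lin mf 1 0 0; rewrite !scale1r addr0.
  by move/(congr1 (fun t => t - f 0)); rewrite addrK subrr.
elim: (repr x) => [y||n s IHs t IHt|c s IHs t IHt|] //=.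
- exact: vm_vac mf.
- by rewrite (vm_prd mf) IHs IHt.
by rewrite (vm_lin mf) IHs IHt.
Qed.

Hypothesis even : forall x : D, opar x = false.

Fact vuniv_even d (x : vuniv) : hom d true x -> x = 0.
Proof.
have tp e p t : thom e p t -> forall (V : vsalg F) (v : D -> V), p -> veval v t = 0.
  elim=> {e p t} [y||e p e' r n s t _ hs _ ht|e p c s t _ hs _ ht|e p] V v //=.
  - by rewrite even.
  - case: p hs => hs; case: r ht => ht // _; first by rewrite hs // prd0l.
    by rewrite ht // prd0r.
  by move=> pp; rewrite hs // ht // scaler0 addr0.
case=> t ht ->; apply: vuniv_eq => V v m.
by rewrite vlift0E // vlift_pi // (tp _ _ _ ht).
Qed.

Definition vuniv_valg : valg F := VAlg vuniv_even.

End Universal.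

Section Twist.
Variables (F : numFieldType) (V : vsalg F) (q : F).
Hypothesis q0 : q != 0.
Let ax := vs_axioms V.

Definition tw_prd (n : int) (u v : V) : V := q ^ (- n - 1) *: prd n u v.

Fact twist_axioms : vertex_axioms (vac : V) tw_prd (@hom F V).
Proof.
rewrite /tw_prd; split; try by [apply: (va_hom0 ax)|apply: (va_homD ax)|apply: (va_hom_neg ax)
  |apply: (va_hom_span ax)|apply: (va_hom_direct ax)|apply: (va_hom_vac ax)].
- by move=> n c u u' v; rewrite (va_linl ax) scalerDr !scalerA mulrC.
- by move=> n c u v v'; rewrite (va_linr ax) scalerDr !scalerA mulrC.
- by move=> d p e r n u v hu hv; apply: homZ; apply: (va_hom_prd ax).
- by move=> n u; rewrite (va_vacl ax); case: eqP => [->|_]; rewrite ?scaler0 ?expr0z ?scale1r.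
- by move=> u; rewrite (va_vacr ax) expr0z scale1r.
- by move=> n u n0; rewrite (va_vacr0 ax) // scaler0.
move=> d p a e r b c l m n M ha hb HM.
have nz k : q ^ k != 0 by rewrite expfz_neq0.
have HM' j : (M <= j)%N ->
  [/\ prd (l + j%:Z) a b = 0, prd (n + j%:Z) b c = 0 & prd (m + j%:Z) a c = 0].
  by move=> /HM[/eqP h1 /eqP h2 /eqP h3]; move: h1 h2 h3;
    rewrite !scaler_eq0 !(negPf (nz _)) => /eqP h1 /eqP h2 /eqP h3.
have E := va_borcherds ax ha hb HM'.
transitivity (q ^ (- (l + m + n) - 2) *:
  \sum_(j < M) gbin F m j *: prd (m + n - j%:Z) (prd (l + j%:Z) a b) c).
  rewrite scaler_sumr; apply: eq_bigr => j _; rewrite prdZl !scalerA.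
  rewrite -mulrA -expfzDr // mulrC; congr (_ * _ *: _); congr (_ ^ _); lia.
rewrite E scaler_sumr; apply: eq_bigr => j _; rewrite !prdZr.
symmetry; rewrite [RHS]scalerA [X in _ = X *: _]mulrC -[RHS]scalerA; congr (_ *: _).
rewrite scalerBr !scalerA; congr (_ *: _ - _ *: _).
  by rewrite -expfzDr //; congr (_ ^ _); lia.
rewrite [RHS]mulrC -[LHS]mulrA -expfzDr //; congr (_ * _); congr (_ ^ _); lia.
Qed.

Definition twist : vsalg F := VSAlg twist_axioms.

End Twist.

Section Rescaling.
Variables (F : numFieldType) (D : ope_data F) (q : F) (w : D -> int).
Hypothesis q0 : q != 0.
Let T := twist (vuniv D) q0.
Let sc (x : D) : T := q ^ (w x) *: ugen x.
Hypothesis compat : forall (n : nat) (x y : D),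
  veval sc (ope n x y) = q ^ (w x + w y - n%:Z - 1) *: veval (@ugen F D) (ope n x y).

Fact rescale_model : ope_model sc.
Proof.
split=> [x|n x y]; first by apply: homZ; apply: (om_hom (ugen_model D)).
rewrite compat -(om_ope (ugen_model D)) /= /tw_prd prdZl prdZr !scalerA.
by rewrite -!expfzDr //; congr (_ ^ _ *: _); lia.
Qed.

Definition rescale : vuniv D -> vuniv D := vlift sc.

Lemma rescale_lin c x y : rescale (c *: x + y) = c *: rescale x + rescale y.
Proof. exact: (vm_lin (vlift_morphism rescale_model)). Qed.
Lemma rescale0 : rescale 0 = 0.
Proof. by rewrite -[0 in LHS](addNr 0) -scaleN1r rescale_lin scaleN1r addNr. Qed.
Lemma rescaleZ c x : rescale (c *: x) = c *: rescale x.
Proof. by rewrite -[c *: x]addr0 rescale_lin rescale0 addr0. Qed.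
Lemma rescaleD x y : rescale (x + y) = rescale x + rescale y.
Proof. by rewrite -[x]scale1r rescale_lin !scale1r. Qed.
Lemma rescale_sum I (r : seq I) (P : pred I) (f : I -> vuniv D) :
  rescale (\sum_(i <- r | P i) f i) = \sum_(i <- r | P i) rescale (f i).
Proof. by apply: big_morph => [x y|]; rewrite ?rescaleD ?rescale0. Qed.
Lemma rescale_vac : rescale vac = vac.
Proof. exact: (vm_vac (vlift_morphism rescale_model)). Qed.
Lemma rescale_prd n x y :
  rescale (prd n x y) = q ^ (- n - 1) *: prd n (rescale x) (rescale y).
Proof. exact: (vm_prd (vlift_morphism rescale_model)). Qed.
Lemma rescale_gen x : rescale (ugen x) = q ^ (w x) *: ugen x.
Proof. exact: (vlift_ugen x rescale_model). Qed.

End Rescaling.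

(* Columns, rows and indices of [gl(N)] are counted from 1. *)

Section Partition.
Variable q : seq nat.

Definition qpart (s : nat) : nat := nth 0%N q s.-1.
Definition psum (s : nat) : nat := sumn (take s q).
Definition col (i : nat) : nat := find (fun s => (i <= psum s)%N) (iota 0 (size q).+1).
Definition row (i : nat) : nat := (i - psum (col i).-1 + qpart 1 - qpart (col i))%N.
(* [n_a], with [n_{v+1} = 0]; [v] is [ndist]. *)
Definition nval (a : nat) : nat := nth 0%N (undup q) a.-1.
Definition ndist : nat := size (undup q).
Definition bval (a : nat) : nat := count (fun x => nval a <= x)%N q.

Variables (F : numFieldType) (k : F).
Definition alpha (s : nat) : F := k + (sumn q)%:R - (qpart s)%:R.
Definition gamma (s : nat) : F := \sum_(s.+1 <= u < (size q).+1) alpha u.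
End Partition.

(* The Lie algebra spanned by the matrix units [E_{i,j}] with [P i j] ([P] is
   transitive in all uses), with invariant form [form i j p r = (E_{i,j} | E_{p,r})]. *)

Section Affine.
Variables (F : numFieldType) (P : rel nat) (form : nat -> nat -> nat -> nat -> F).

Definition munit := {x : nat * nat | P x.1 x.2}.

Definition munit_term (G : Type) (g : munit -> G) (i j : nat) : vterm F G :=
  if insub (i, j) is Some x then VGen F (g x) else VZero F G.

Definition bracket_term (G : Type) (g : munit -> G) (x y : munit) : vterm F G :=
  let: (i, j) := val x in let: (p, r) := val y in
  VLin (j == p)%:R (munit_term g i r)
    (VLin (- (i == r)%:R) (munit_term g p j) (VZero F G)).

Definition form_term (G : Type) (x y : munit) : vterm F G :=
  VLin (form (val x).1 (val x).2 (val y).1 (val y).2) (VVac F G) (VZero F G).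

Definition affine_ope (n : nat) (x y : munit) : vterm F munit :=
  match n with
  | 0 => bracket_term id x y
  | 1 => form_term munit x y
  | _ => VZero F munit
  end.

Definition affine_data : ope_data F :=
  OPEData (fun=> 1) (fun=> false) affine_ope.

Definition affine : valg F := vuniv_valg (D := affine_data) (fun=> erefl).

(* The vector [E_{i,j} t^{-1}], read as 0 if the Lie algebra does not contain [E_{i,j}]. *)
Definition affE (i j : nat) : affine :=
  if insub (i, j) is Some x then ugen (D := affine_data) x else 0.

End Affine.

Section WAlgebra.
Variables (F : numFieldType) (q : seq nat) (k : F).
Let N := sumn q.
Local Notation col := (col q).
Local Notation row := (row q).

Definition in_gl (i j : nat) : bool := (0 < i <= N)%N && (0 < j <= N)%N.
Definition in_levi (i j : nat) : bool := in_gl i j && (col i == col j).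
(* strictly positive part for the grading deg E_{i,j} = col(j) - col(i) *)
Definition in_npos (i j : nat) : bool := in_gl i j && (col i < col j)%N.

Definition gl_form (i j p r : nat) : F :=
  k * ((i == r) && (p == j))%:R + ((i == j) && (p == r))%:R.

(* orthogonal sum of the forms [kappa_s] on the blocks [gl(q_s)] *)
Definition levi_form (i j p r : nat) : F :=
  if col i == col p then
    alpha q k (col i) * ((j == p) && (i == r))%:R + ((i == j) && (p == r))%:R
  else 0.

(* The tensor product of the [V^{kappa_s}(gl(q_s))] is the universal affine
   vertex algebra of the direct sum of the [gl(q_s)]. *)
Definition levi_va : valg F := affine in_levi levi_form.
Definition leviE (i j : nat) : levi_va := affE in_levi levi_form i j.

(* [V^k(gl(N))] tensored with the charged free fermions [phi_u] (Gho) and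
   [phi_u^*] (Ant), where [u] runs through the matrix units of positive degree. *)

Inductive brst_gen :=
| Cur of munit in_gl
| Gho of munit in_npos
| Ant of munit in_npos.

Definition brst_wt (x : brst_gen) : int := if x is Ant _ then 0 else 1.
Definition brst_par (x : brst_gen) : bool := if x is Cur _ then false else true.

Definition brst_ope (n : nat) (x y : brst_gen) : vterm F brst_gen :=
  match n, x, y with
  | 0, Cur u, Cur v => bracket_term F Cur u v
  | 1, Cur u, Cur v => form_term gl_form brst_gen u v
  | 0, Gho u, Ant v | 0, Ant u, Gho v =>
      if val u == val v then VVac F brst_gen else VZero F brst_gen
  | _, _, _ => VZero F brst_gen
  end.

Definition brst_data : ope_data F := OPEData brst_wt brst_par brst_ope.
Definition brst : vsalg F := vuniv brst_data.

(* These vanish when [E_{i,j}] is not in gl(N), resp. not of positive degree. *)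
Definition cur (i j : nat) : brst :=
  if insub (i, j) is Some x then ugen (D := brst_data) (Cur x) else 0.
Definition gho (i j : nat) : brst :=
  if insub (i, j) is Some x then ugen (D := brst_data) (Gho x) else 0.
Definition ant (i j : nat) : brst :=
  if insub (i, j) is Some x then ugen (D := brst_data) (Ant x) else 0.

(* [chi i j] is the trace of [f * E_{i,j}], that is the coefficient of
   [E_{j,i}] in [f]. *)
Definition chi (i j : nat) : F := ((col j == (col i).+1) && (row i == row j))%:R.

(* The differential is the zero mode of
   sum_u :u phi_u^*: + sum_u chi(u) phi_u^* - 1/2 sum :phi_{[u,v]} phi_u^* phi_v^*:,
   and [u,v] <> 0 for matrix units of positive degree only if
   {u,v} = {E_{i,j}, E_{j,p}}. *)
Definition brst_charge : brst :=
  \sum_(1 <= i < N.+1) \sum_(1 <= j < N.+1) prd (-1) (cur i j) (ant i j)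
  + \sum_(1 <= i < N.+1) \sum_(1 <= j < N.+1) chi i j *: ant i j
  - \sum_(1 <= i < N.+1) \sum_(1 <= j < N.+1) \sum_(1 <= p < N.+1)
      prd (-1) (gho i p) (prd (-1) (ant i j) (ant j p)).

(* J^{(a)} = a + sum_u :phi_{[a,u]_+} phi_u^*: for [a = E_{i,j}], where [x_+] is
   the component of [x] of positive degree. *)
Definition brst_J (i j : nat) : brst :=
  cur i j + \sum_(1 <= p < N.+1) prd (-1) (gho i p) (ant j p)
  - \sum_(1 <= p < N.+1) prd (-1) (gho p j) (ant p i).

(* The J^{(a)} with [a] of degree at most 0 generate the universal affine vertex
   algebra of the span of the E_{i,j} with col(i) >= col(j), and each class in
   the 0-th BRST cohomology is represented by exactly one cocycle in that vertex
   subalgebra. The Miura map sends J^{(a)} to the block-diagonal part of [a]; the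
   following relation is the graph of this homomorphism of vertex algebras. *)
Inductive miura : brst -> levi_va -> Prop :=
| miura_J i j of in_gl i j & (col j <= col i)%N : miura (brst_J i j) (leviE i j)
| miura_vac : miura vac vac
| miura_lin c u v x y of miura u x & miura v y : miura (c *: u + v) (c *: x + y)
| miura_prd n u v x y of miura u x & miura v y : miura (prd n u v) (prd n x y).

Definition in_walg (x : levi_va) : Prop :=
  exists2 c : brst, prd 0 brst_charge c = 0 & miura c x.

(* [in_walg] is a vertex subalgebra: the differential is an odd derivation, and
   it preserves the weights for which J^{(a)} has weight 1 - deg a. *)

Lemma hom_cur i j : hom 1 false (cur i j).
Proof.
rewrite /cur; case: insubP => [x _ _|_]; last exact: (va_hom0 (vs_axioms brst)).
exact: (om_hom (ugen_model brst_data) (Cur x)).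
Qed.
Lemma hom_gho i j : hom 1 true (gho i j).
Proof.
rewrite /gho; case: insubP => [x _ _|_]; last exact: (va_hom0 (vs_axioms brst)).
exact: (om_hom (ugen_model brst_data) (Gho x)).
Qed.
Lemma hom_ant i j : hom 0 true (ant i j).
Proof.
rewrite /ant; case: insubP => [x _ _|_]; last exact: (va_hom0 (vs_axioms brst)).
exact: (om_hom (ugen_model brst_data) (Ant x)).
Qed.

Let odd_vec (u : brst) : Prop := exists d, hom d true u.
Let even_vec (u : brst) : Prop := exists d, hom d false u.

Lemma brst_charge_odd : span odd_vec brst_charge.
Proof.
have ax := vs_axioms brst.
apply: span_sub; [apply: span_add|]; do ![apply: span_sum => ? _].
- by apply: span_inc; eexists; apply: (va_hom_prd ax _ (hom_cur _ _) (hom_ant _ _)).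
- by apply: span_scale; apply: span_inc; eexists; apply: hom_ant.
apply: span_inc; eexists.
exact: (va_hom_prd ax _ (hom_gho _ _) (va_hom_prd ax _ (hom_ant _ _) (hom_ant _ _))).
Qed.

Lemma brst_J_even i j : span even_vec (brst_J i j).
Proof.
have ax := vs_axioms brst.
apply: span_sub; [apply: span_add|]; do ?[apply: span_sum => ? _].
- by apply: span_inc; eexists; apply: hom_cur.
- by apply: span_inc; eexists; apply: (va_hom_prd ax _ (hom_gho _ _) (hom_ant _ _)).
by apply: span_inc; eexists; apply: (va_hom_prd ax _ (hom_gho _ _) (hom_ant _ _)).
Qed.

Lemma miura_even u x : miura u x -> span even_vec u.
Proof.
have ax := vs_axioms brst.
elim=> {u x} [i j _ _||c u v x y _ su _ sv|n u v x y _ su _ sv].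
- exact: brst_J_even.
- by apply: span_inc; exists 0; apply: (va_hom_vac ax).
- by apply: span_add => //; apply: span_scale.
move: su; apply: (span_map (f := fun t => prd n t v)).
  by move=> c s t; rewrite (va_linl ax).
move=> s [d hs]; move: sv; apply: (span_map (f := fun t => prd n s t)).
  by move=> c t t'; rewrite (va_linr ax).
by move=> t [e ht]; apply: span_inc; eexists; apply: (va_hom_prd ax _ hs ht).
Qed.

Lemma brst_derivation n u v : span even_vec u ->
  prd 0 brst_charge (prd n u v) =
  prd n (prd 0 brst_charge u) v + prd n u (prd 0 brst_charge v).
Proof.
have ax := vs_axioms brst => su.
elim: brst_charge_odd => [|c Q1 Q2 [d hQ] _ IH].
  by rewrite !prd0l prd0r addr0.
rewrite !(va_linl ax) !(va_linr ax) IH addrACA -scalerDr; congr (_ *: _ + _).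
elim: su => [|c' x y [e hx] _ IHx]; first by rewrite prd0r !prd0l prd0r addr0.
rewrite !(va_linl ax, va_linr ax) IHx addrACA -scalerDr; congr (_ *: _ + _).
by rewrite (prd0_comm v n hQ hx) expr0 scale1r.
Qed.

Definition ds_wt (x : brst_data) : int :=
  match x with
  | Cur u | Gho u => 1 + (col (val u).1)%:Z - (col (val u).2)%:Z
  | Ant u => (col (val u).2)%:Z - (col (val u).1)%:Z
  end.

Fact two_neq0 : 2 != 0 :> F. Proof. by rewrite pnatr_eq0. Qed.

Fact veval_munit (P : rel nat) (X : Type) (V : vsalg F) (v : X -> V) (g : munit P -> X) i j :
  veval v (munit_term F g i j) = if insub (i, j) is Some x then v (g x) else 0.
Proof. by rewrite /munit_term; case: insub. Qed.

Lemma ds_compat (n : nat) (x y : brst_data) :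
  veval (V := twist brst two_neq0) (fun z : brst_data => 2 ^ (ds_wt z) *: ugen z) (ope n x y) =
  2 ^ (ds_wt x + ds_wt y - n%:Z - 1) *: veval (@ugen F brst_data) (ope n x y).
Proof.
case: n => [|[|n]]; case: x => x; case: y => y; rewrite /= ?scaler0 //.
- case: x y => [[i j] /= xP] [[p r] /= yP]; rewrite /bracket_term /= !veval_munit !addr0.
  rewrite scalerDr !scalerA; congr (_ + _).
    case: eqP => [jp|_]; last by rewrite !(mulr0n, mul0r, mulr0, scale0r).
    case: insubP => [z _ ez|_]; rewrite ?scaler0 // mulr1n scale1r mulr1.
    by congr (_ ^ _ *: _); rewrite /= ez /= jp; lia.
  case: eqP => [ir|_]; last by rewrite !(mulr0n, oppr0, mul0r, mulr0, scale0r).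
  case: insubP => [z _ ez|_]; rewrite ?scaler0 // scalerA mulrC.
  by congr (_ ^ _ * _ *: _); rewrite /= ez /= ir; lia.
- case: eqP => [xy|_] /=; rewrite ?scaler0 // xy.
  set e := (X in _ ^ X); suff -> : e = 0 by rewrite expr0z scale1r.
  by rewrite /e; lia.
- case: eqP => [xy|_] /=; rewrite ?scaler0 // xy.
  set e := (X in _ ^ X); suff -> : e = 0 by rewrite expr0z scale1r.
  by rewrite /e; lia.
case: x y => [[i j] /= xP] [[p r] /= yP]; rewrite /form_term /= !addr0 scalerA /gl_form.
have [/andP[/eqP -> /eqP ->]|_] := boolP ((i == r) && (p == j)); last first.
  have [/andP[/eqP -> /eqP ->]|_] := boolP ((i == j) && (p == r)); last first.
    by rewrite !(mulr0n, mulr0, addr0, scale0r).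
  set e := (X in _ ^ X); suff -> : e = 0 by rewrite expr0z mul1r.
  by rewrite /e; lia.
set e := (X in _ ^ X); suff -> : e = 0 by rewrite expr0z mul1r.
by rewrite /e; lia.
Qed.

Let rho := rescale ds_wt two_neq0.

Lemma rho_cur i j : rho (cur i j) = 2 ^ (1 + (col i)%:Z - (col j)%:Z) *: cur i j.
Proof.
rewrite /cur; case: insubP => [x _ ex|_].
  by rewrite [LHS](rescale_gen ds_compat) /= ex.
by rewrite scaler0 [LHS](rescale0 ds_compat).
Qed.
Lemma rho_gho i j : rho (gho i j) = 2 ^ (1 + (col i)%:Z - (col j)%:Z) *: gho i j.
Proof.
rewrite /gho; case: insubP => [x _ ex|_].
  by rewrite [LHS](rescale_gen ds_compat) /= ex.
by rewrite scaler0 [LHS](rescale0 ds_compat).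
Qed.
Lemma rho_ant i j : rho (ant i j) = 2 ^ ((col j)%:Z - (col i)%:Z) *: ant i j.
Proof.
rewrite /ant; case: insubP => [x _ ex|_].
  by rewrite [LHS](rescale_gen ds_compat) /= ex.
by rewrite scaler0 [LHS](rescale0 ds_compat).
Qed.

Lemma rho_prd d e n u v : rho u = 2 ^ d *: u -> rho v = 2 ^ e *: v ->
  rho (prd n u v) = 2 ^ (d + e - n - 1) *: prd n u v.
Proof.
move=> hu hv; rewrite [LHS](rescale_prd ds_compat) -/rho hu hv prdZl prdZr !scalerA.
by rewrite -!expfzDr ?two_neq0 //; congr (_ ^ _ *: _); lia.
Qed.

Lemma rho_sum d I (r : seq I) (f : I -> brst) :
  (forall i, rho (f i) = 2 ^ d *: f i) ->
  rho (\sum_(i <- r) f i) = 2 ^ d *: \sum_(i <- r) f i.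
Proof.
move=> h; rewrite [LHS](rescale_sum ds_compat) scaler_sumr.
by apply: eq_bigr => i _; apply: h.
Qed.

Lemma rho_add d u v : rho u = 2 ^ d *: u -> rho v = 2 ^ d *: v ->
  rho (u + v) = 2 ^ d *: (u + v).
Proof. by move=> hu hv; rewrite [LHS](rescaleD ds_compat) -/rho hu hv scalerDr. Qed.
Lemma rho_scale d c u : rho u = 2 ^ d *: u -> rho (c *: u) = 2 ^ d *: (c *: u).
Proof. by move=> hu; rewrite [LHS](rescaleZ ds_compat) -/rho hu !scalerA mulrC. Qed.
Lemma rho_opp d u : rho u = 2 ^ d *: u -> rho (- u) = 2 ^ d *: - u.
Proof. by rewrite -scaleN1r; apply: rho_scale. Qed.

Lemma rho_charge : rho brst_charge = 2 *: brst_charge.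
Proof.
rewrite -[2 in RHS]expr1z; apply: rho_add; last apply: rho_opp; first apply: rho_add.
- apply: rho_sum => i; apply: rho_sum => j.
  rewrite (rho_prd _ (rho_cur i j) (rho_ant i j)); congr (_ ^ _ *: _); lia.
- apply: rho_sum => i; apply: rho_sum => j; rewrite /chi; case: eqP => [cij|_]; last first.
    by rewrite andFb scale0r [LHS](rescale0 ds_compat) scaler0.
  by apply: rho_scale; rewrite rho_ant cij; congr (_ ^ _ *: _); lia.
apply: rho_sum => i; apply: rho_sum => j; apply: rho_sum => p.
rewrite (rho_prd _ (rho_gho i p) (rho_prd _ (rho_ant i j) (rho_ant j p))).
by congr (_ ^ _ *: _); lia.
Qed.

Lemma levi_compat (n : nat) (x y : affine_data in_levi levi_form) :
  veval (V := twist levi_va two_neq0)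
    (fun z : affine_data in_levi levi_form => 2 ^ (1 : int) *: ugen z) (ope n x y) =
  2 ^ (1 + 1 - n%:Z - 1 : int) *: veval (@ugen F (affine_data in_levi levi_form)) (ope n x y).
Proof.
case: n => [|[|n]]; rewrite /= ?scaler0 //.
  case: x y => [[i j] /= xP] [[p r] /= yP]; rewrite /bracket_term /= !veval_munit !addr0.
  by rewrite scalerDr !scalerA; congr (_ + _); rewrite [X in _ = X *: _]mulrC -scalerA;
    congr (_ *: _); case: insub => [z|]; rewrite ?scaler0.
by rewrite /form_term /= !addr0 scalerA expr0z mul1r.
Qed.

Let rho_levi := rescale (D := affine_data in_levi levi_form) (fun=> 1) two_neq0.

Lemma rho_leviE i j : rho_levi (leviE i j) = 2 *: leviE i j.
Proof.
rewrite /leviE /affE; case: insub => [x|].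
  by rewrite [LHS](rescale_gen levi_compat) expr1z.
by rewrite scaler0 [LHS](rescale0 levi_compat).
Qed.

Lemma rho_levi_hom d p (x : levi_va) : hom d p x -> rho_levi x = 2 ^ d *: x.
Proof.
case=> t ht ->; rewrite -veval_ugen [LHS](_ : _ = veval (V := twist levi_va two_neq0)
  (fun z : affine_data in_levi levi_form => 2 ^ (1 : int) *: ugen z) t); last first.
  by rewrite veval_ugen [LHS](vlift_pi _ (rescale_model levi_compat)).
elim: ht => {d p t} [z||d p e r n s t _ hs _ ht|d p c s t _ hs _ ht|d p] /=.
- by [].
- by rewrite expr0z scale1r.
- rewrite hs ht /tw_prd prdZl prdZr !scalerA.
  by rewrite -!expfzDr ?two_neq0 //; congr (_ ^ _ *: _); lia.
- by rewrite hs ht scalerDr !scalerA mulrC.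
by rewrite scaler0.
Qed.

Lemma rho_J i j : rho (brst_J i j) = 2 ^ (1 + (col i)%:Z - (col j)%:Z) *: brst_J i j.
Proof.
apply: rho_add; last apply: rho_opp; first apply: rho_add; first exact: rho_cur.
- apply: rho_sum => p; rewrite (rho_prd _ (rho_gho i p) (rho_ant j p)).
  by congr (_ ^ _ *: _); lia.
apply: rho_sum => p; rewrite (rho_prd _ (rho_gho p j) (rho_ant p i)).
by congr (_ ^ _ *: _); lia.
Qed.

Lemma miura_scale c u x : miura u x -> miura (c *: u) (c *: x).
Proof.
move=> m; have m0 : miura 0 0.
  have := miura_lin (-1) miura_vac miura_vac; by rewrite !scaleN1r !addNr.
by have := miura_lin c m m0; rewrite !addr0.
Qed.

Lemma miura_rho u x : miura u x -> miura (rho u) (rho_levi x).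
Proof.
elim=> {u x} [i j gij cij||c u v x y _ mu _ mv|n u v x y _ mu _ mv].
- rewrite rho_J rho_leviE; have mJ := miura_J gij cij.
  have [eij|nij] := eqVneq (col i) (col j).
    by rewrite eij addrK expr1z; apply: miura_scale.
  suff e0 : leviE i j = 0.
    have := miura_scale (2 ^ (1 + (col i)%:Z - (col j)%:Z)) mJ.
    by rewrite e0 !scaler0.
  by rewrite /leviE /affE insubF //= /in_levi (negPf nij) andbF.
- have := miura_vac.
  by rewrite -{1}(rescale_vac ds_compat) -[X in miura _ X](rescale_vac levi_compat).
- have := miura_lin c mu mv.
  by rewrite -(rescale_lin ds_compat) -(rescale_lin levi_compat).
have := miura_scale (2 ^ (- n - 1)) (miura_prd n mu mv).
by rewrite -(rescale_prd ds_compat) -(rescale_prd levi_compat).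
Qed.

Lemma in_walg_lin c x y : in_walg x -> in_walg y -> in_walg (c *: x + y).
Proof.
case=> u Qu mu [v Qv mv]; exists (c *: u + v); last exact: miura_lin.
by rewrite (va_linr (vs_axioms brst)) Qu Qv scaler0 addr0.
Qed.

Lemma in_walg_rho x : in_walg x -> in_walg (rho_levi x).
Proof.
case=> u Qu mu; exists (rho u); last exact: miura_rho.
have : rho (prd 0 brst_charge u) = 0 by rewrite Qu [LHS](rescale0 ds_compat).
rewrite [LHS](rescale_prd ds_compat) -/rho rho_charge prdZl scalerA.
rewrite -[X in _ * X]expr1z -expfzDr ?two_neq0 // expr0z scale1r. by [].
Qed.

Lemma in_walg0 : in_walg 0.
Proof.
exists 0; first by rewrite prd0r.
by rewrite -(scale0r vac) -[X in miura _ X](scale0r vac); apply: miura_scale; constructor.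
Qed.

Lemma pow2_inj (d e : int) : 2 ^ d = 2 ^ e :> F -> d = e.
Proof.
wlog le_de : d e / d <= e => [IH|E].
  by case/orP: (le_total d e) => h E; [apply: IH|apply/esym/IH].
suff : `|e - d|%N = 0%N by lia.
have : 2 ^ (e - d) = 1 :> F by rewrite expfzDr ?two_neq0 // -E -expfzDr ?two_neq0 // subrr expr0z.
have -> : e - d = `|e - d|%N%:Z by lia.
rewrite absz_nat -exprnP -natrX => /eqP; rewrite pnatr_eq1.
by case: `|_|%N => // m /eqP; rewrite expnS; lia.
Qed.

Lemma in_walg_comp (ds : seq int) (f : int -> levi_va) :
  uniq ds -> (forall d, rho_levi (f d) = 2 ^ d *: f d) ->
  in_walg (\sum_(d <- ds) f d) -> forall d, d \in ds -> in_walg (f d).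
Proof.
elim: ds f => [|d0 ds IH] f //= /andP[d0ds uds] hf; rewrite big_cons => hs.
have key : forall d, d \in ds -> in_walg (f d).
  move=> d dds; have dd0 : 2 ^ d - 2 ^ d0 != 0 :> F.
    by rewrite subr_eq0; apply: contraNneq d0ds => /pow2_inj <-.
  suff w : in_walg ((2 ^ d - 2 ^ d0) *: f d).
    have := in_walg_lin (2 ^ d - 2 ^ d0)^-1 w in_walg0.
    by rewrite scalerA mulVf // scale1r addr0.
  apply: (IH (fun e => (2 ^ e - 2 ^ d0) *: f e) uds) => // [e|].
    by rewrite [LHS](rescaleZ levi_compat) -/rho_levi hf !scalerA mulrC.
  have := in_walg_lin (- 2 ^ d0) hs (in_walg_rho hs).
  rewrite [rho_levi _](rescaleD levi_compat) -/rho_levi hf [rho_levi _](rescale_sum levi_compat).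
  rewrite scalerDr addrACA -scalerDl addNr scale0r add0r scaler_sumr -big_split /=.
  by rewrite (eq_bigr (fun e => (2 ^ e - 2 ^ d0) *: f e)) // => e _;
    rewrite -/rho_levi hf -scalerDl addrC.
move=> d; rewrite inE => /predU1P[->|]; last exact: key.
have sw : in_walg (\sum_(e <- ds) f e).
  rewrite big_seq; elim/big_rec: _ => [|e x eds wx]; first exact: in_walg0.
  by rewrite -[f e]scale1r; apply: in_walg_lin => //; apply: key.
by have := in_walg_lin (-1) sw hs; rewrite scaleN1r addrC addrK.
Qed.

Lemma in_walg_subva : is_subva in_walg.
Proof.
have ax := vs_axioms levi_va.
split.
- by exists vac; [apply: (va_vacr0 (vs_axioms brst))|constructor].
- exact: in_walg_lin.
- move=> n x y [u Qu mu] [v Qv mv]; exists (prd n u v); last exact: miura_prd.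
  by rewrite brst_derivation ?Qu ?Qv ?prd0l ?prd0r ?addr0 //; apply: miura_even mu.
move=> x wx; have [ks [f [uks hf ex]]] := hom_dec x.
have f1 d : f (d, true) = 0 by apply: (va_even (hf (d, true))).
pose ds := undup (map fst ks); pose g d := \sum_(z <- ks | z.1 == d) f z.
have hg d : hom d false (g d).
  by apply: hom_sum => -[e [|]] /eqP /= <-; [rewrite f1; apply: (va_hom0 ax)|apply: (hf (e, false))].
have ex' : x = \sum_(d <- ds) g d.
  rewrite ex /g (exchange_big_dep predT) //= big_seq [RHS]big_seq; apply: eq_bigr => z zk.
  rewrite (eq_bigl (pred1 z.1)) => [|d]; last by rewrite eq_sym.
  rewrite -big_filter filter_pred1_uniq ?undup_uniq ?big_seq1 //.
  by rewrite mem_undup; apply: map_f.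
rewrite ex' big_seq; apply: span_sum => d dds; apply: span_inc.
split; last by exists d, false.
move: d dds; apply: in_walg_comp; rewrite ?undup_uniq -?ex' //.
by move=> d; apply: rho_levi_hom (hg d).
Qed.

Definition walg : valg F := subvalg in_walg_subva.

(* [E^{(s)}_{p,r} t^{-1}]: the matrix unit whose row and column index lie in column
   [s], in rows [p] and [r]. *)
Definition blockE (s p r : nat) : levi_va :=
  let o := (qpart q 1 - qpart q s)%N in
  if (o < p <= qpart q 1)%N && (o < r <= qpart q 1)%N then
    leviE (psum q s.-1 + (p - o)) (psum q s.-1 + (r - o))
  else 0.

(* Multiplication by [E^{(s)}_{p,r}[-u]]. *)
Definition Emode (s p r u : nat) : levi_va -> levi_va := prd (- u%:Z) (blockE s p r).

Local Notation l := (size q).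

Definition W1 (p r : nat) : levi_va := \sum_(1 <= s < l.+1) Emode s p r 1 vac.

(* [W2 a p r] is W^(2)_{p,r} for q_1 - n_a < p, r <= q_1 - n_{a+1}. *)
Definition W2 (a p r : nat) : levi_va :=
  let q1 := qpart q 1 in let na := nval q a in
  - \sum_(1 <= s < l.+1) gamma q k s *: Emode s p r 2 vac
  + \sum_(1 <= r1 < l.+1) \sum_(1 <= r2 < l.+1 | (r1 < r2)%N)
      \sum_((q1 - na).+1 <= u < q1.+1) Emode r1 u r 1 (Emode r2 p u 1 vac)
  - \sum_(1 <= r1 < l.+1) \sum_(1 <= r2 < l.+1 | (r2 <= r1)%N)
      \sum_((q1 - qpart q r2).+1 <= u < (q1 - na).+1) Emode r1 u r 1 (Emode r2 p u 1 vac).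

Definition slW (w : walg) : Prop :=
  exists x : 'M[F]_(nval q 1 - nval q 2),
    \tr x = 0 /\ val w = \sum_i \sum_j x i j *: W1 i.+1 j.+1.

Fact slW_hom (w : walg) : slW w -> exists d p, hom d p w.
Proof.
have ax := vs_axioms levi_va.
case=> x [_ ew]; exists 1, false.
suff : hom 1 false (val w : levi_va) by [].
rewrite ew.
apply: hom_sum => i _; apply: hom_sum => j _; apply: homZ.
apply: hom_sum => s _; rewrite /Emode (va_vacr ax) /blockE.
case: ifP => _; last exact: (va_hom0 ax).
rewrite /leviE /affE; case: insub => [z|]; last exact: (va_hom0 ax).
exact: (om_hom (ugen_model (affine_data in_levi levi_form)) z).
Qed.

Definition slV : walg -> Prop := vgen slW.

Definition walg_coset : valg F := coset (vgen_subva slW_hom : is_subva slV).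

End WAlgebra.

Section EnvelopingAlgebra.
Variables (F : numFieldType) (V : valg F).
Let ax := vs_axioms V.

(* Relations of U(L(V)) for the generators [u t^a]: linearity in [u], translation
   ([vac_{(-2)}], i.e. [prd (-2) u vac], is the derivative of [u]) and the
   commutator formula, whose sum is cut where its terms vanish. *)
Record LV_rel (A : pzAlgType F) (m : V * int -> A) : Prop := {
  LV_lin : forall c u v a, m (c *: u + v, a) = c *: m (u, a) + m (v, a);
  LV_der : forall u a, m (prd (-2) u vac, a) + a%:~R *: m (u, a - 1) = 0;
  LV_comm : forall u v a b (M : nat),
    (forall r : nat, (M <= r)%N -> prd r%:Z u v = 0) ->
    comm (m (u, a)) (m (v, b)) =
    \sum_(r < M) gbin F a r *: m (prd r%:Z u v, a + b - r%:Z)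
}.

Definition ULV : pzAlgType F := palg LV_rel.
Definition lmode (u : V) (a : int) : ULV := pgen LV_rel (u, a).

Lemma ULV_rel : LV_rel (fun x : V * int => pgen LV_rel x : ULV).
Proof.
have lE (A : pzAlgType F) (v : V * int -> A) (m : LV_rel v) := plift_morph m.
have linE (A : pzAlgType F) (v : V * int -> A) (m : LV_rel v) c (x y : ULV) :
    plift v (c *: x + y) = c *: plift v x + plift v y by case: (lE _ _ m).
have sumE (A : pzAlgType F) (v : V * int -> A) (m : LV_rel v) I (r : seq I) (f : I -> ULV) :
    plift v (\sum_(i <- r) f i) = \sum_(i <- r) plift v (f i).
  apply: (big_morph (plift v : ULV -> A)) => [x y|].
    by rewrite -[x in LHS]scale1r linE // scale1r.
  exact: plift0E.
split=> [c u v a|u a|u v a b M hM]; apply: palg_eq => A v' m.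
- by rewrite linE // !plift_gen // (LV_lin m).
- by rewrite addrC linE // !plift_gen // addrC (LV_der m) plift0E.
rewrite /comm -scaleN1r addrC linE // !pliftME // !plift_gen // scaleN1r addrC.
rewrite -[LHS]/(comm _ _) (LV_comm m a b hM) sumE //; apply: eq_bigr => r _.
by rewrite -[X in plift v' X]addr0 linE // plift_gen // plift0E // addr0.
Qed.

(* The degree of [u t^a] is wt(u) - a - 1. *)
Inductive mono : int -> ULV -> Prop :=
| mono_one : mono 0 1
| mono_mul d p u a e x of hom d p u & mono e x : mono (d - a - 1 + e) (lmode u a * x).

(* sums of homogeneous elements of degree between -D and D *)
Definition Ubounded (D : nat) : ULV -> Prop :=
  span (fun x => exists d, (`|d| <= D)%N /\ mono d x).

(* the left ideal generated by the homogeneous elements of degree at most -N *)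
Definition Ufil (N : nat) : ULV -> Prop :=
  span (fun x => exists y d z, [/\ d <= - N%:Z, mono d z & x = y * z]).

(* Sequences of bounded degree, Cauchy for the topology given by [Ufil]:
   they represent the elements of the degreewise completion of U(L(V)). *)
Definition Ucauchy (x : nat -> ULV) : Prop :=
  (exists D, forall n, Ubounded D (x n)) /\
  (forall N, exists M, forall m n, (M <= m)%N -> (M <= n)%N -> Ufil N (x m - x n)).

Definition Uborch (u v : V) (a b : int) (n : nat) : ULV :=
  lmode (prd a u v) b
  - \sum_(i < n) (gbin F a i * (-1) ^+ i) *:
      (lmode u (a - i%:Z) * lmode v (b + i%:Z)
       - (-1) ^ a *: (lmode v (a + b - i%:Z) * lmode u i%:Z)).

Definition Uvac (n : nat) : ULV := lmode vac (-1) - 1.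

(* The two-sided ideal generated by the elements represented by [Uborch] and [Uvac]. *)
Inductive Uideal : (nat -> ULV) -> Prop :=
| Uideal0 : Uideal (fun=> 0)
| Uideal_borch y g h u v a b of Uideal y & Ucauchy g & Ucauchy h :
    Uideal (fun n => y n + g n * Uborch u v a b n * h n)
| Uideal_vac y g h of Uideal y & Ucauchy g & Ucauchy h :
    Uideal (fun n => y n + g n * Uvac n * h n).

Definition Uclosure (x : nat -> ULV) : Prop :=
  forall N, exists2 y, Uideal y &
    exists M, forall n, (M <= n)%N -> Ufil N (x n - y n).

Lemma mono_mulm d e x y : mono d x -> mono e y -> mono (d + e) (x * y).
Proof.
move=> mx my; elim: mx => [|d' p u a e' z hu _ IH]; first by rewrite add0r mul1r.
by rewrite -mulrA -addrA; apply: mono_mul hu IH.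
Qed.

Lemma mono_lmode d p u a : hom d p u -> mono (d - a - 1) (lmode u a).
Proof.
by move=> hu; have := mono_mul a hu mono_one; rewrite addr0 mulr1.
Qed.

Lemma lmode_lin c u v a : lmode (c *: u + v) a = c *: lmode u a + lmode v a.
Proof. exact: (LV_lin ULV_rel). Qed.
Lemma lmode0 a : lmode 0 a = 0.
Proof.
by have := lmode_lin (-1) 0 0 a; rewrite scaler0 addr0 scaleN1r addNr.
Qed.

Lemma ULV_mulDl c (x y z : ULV) : (c *: x + y) * z = c *: (x * z) + y * z.
Proof. by rewrite mulrDl pzalg_scaleAl. Qed.
Lemma ULV_mulDr c (x y z : ULV) : z * (c *: x + y) = c *: (z * x) + z * y.
Proof. by rewrite mulrDr pzalg_scaleAr. Qed.

Lemma Ubounded_le D D' x : (D <= D')%N -> Ubounded D x -> Ubounded D' x.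
Proof.
move=> DD; apply: span_mono => y [d [dD my]]; exists d; split=> //.
exact: leq_trans DD.
Qed.

Lemma Ubounded_mul D E x y : Ubounded D x -> Ubounded E y -> Ubounded (D + E) (x * y).
Proof.
move=> bx bY; move: bx; apply: (span_map (f := (fun t => t * y) : ULV -> ULV)) => [c s t|s [d [dD ms]]].
  exact: ULV_mulDl.
move: bY; apply: (span_map (f := (fun t => s * t) : ULV -> ULV)) => [c t t'|t [e [eE mt]]].
  exact: ULV_mulDr.
apply: span_inc; exists (d + e); split; last exact: mono_mulm.
by lia.
Qed.

Lemma Ufil_le N N' x : (N <= N')%N -> Ufil N' x -> Ufil N x.
Proof.
move=> NN; apply: span_mono => y [z [d [t [dN mt ->]]]]; exists z, d, t.
by split=> //; lia.
Qed.

Lemma Ufil_mull N x y : Ufil N x -> Ufil N (y * x).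
Proof.
apply: (span_map (f := (fun t => y * t) : ULV -> ULV)) => [c s t|s [z [d [t [dN mt ->]]]]].
  exact: ULV_mulDr.
by apply: span_inc; exists (y * z), d, t; rewrite mulrA.
Qed.

Lemma Ufil_mulr N D x y : Ufil (N + D) x -> Ubounded D y -> Ufil N (x * y).
Proof.
move=> fx bY; move: fx; apply: (span_map (f := (fun t => t * y) : ULV -> ULV)) => [c s t|s].
  exact: ULV_mulDl.
case=> z [d [t [dN mt ->]]].
move: bY; apply: (span_map (f := (fun w => z * t * w) : ULV -> ULV)) => [c w w'|w [e [eD mw]]].
  exact: ULV_mulDr.
apply: span_inc; exists z, (d + e), (t * w); rewrite mulrA; split=> //.
  by lia.
exact: mono_mulm.
Qed.

Lemma Ucauchy_const x : (exists D, Ubounded D x) -> Ucauchy (fun=> x).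
Proof.
case=> D bx; split; first by exists D.
by move=> N; exists 0%N => m n _ _; rewrite subrr; apply: span_nil.
Qed.

Lemma Ucauchy0 : Ucauchy (fun=> 0).
Proof. by apply: Ucauchy_const; exists 0%N; apply: span_nil. Qed.

Lemma Ucauchy1 : Ucauchy (fun=> 1).
Proof.
by apply: Ucauchy_const; exists 0%N; apply: span_inc; exists 0; split=> //; constructor.
Qed.

Lemma Ucauchy_lmode u a : Ucauchy (fun=> lmode u a).
Proof.
apply: Ucauchy_const; elim: (va_hom_span ax u) => [|c v w [d [p hv]] _ [D bw]].
  by exists 0%N; rewrite lmode0; apply: span_nil.
exists (`|(d - a - 1)%R| + D)%N; rewrite lmode_lin; apply: span_add.
  apply: span_scale; apply: span_inc; exists (d - a - 1); split; last exact: mono_lmode hv.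
  exact: leq_addr.
by apply: Ubounded_le bw; apply: leq_addl.
Qed.

Lemma Ucauchy_lin c x y : Ucauchy x -> Ucauchy y -> Ucauchy (fun n => c *: x n + y n).
Proof.
case=> -[D bx] cx [[E bY] cy]; split.
  exists (D + E)%N => n; apply: span_add.
    by apply: span_scale; apply: Ubounded_le (bx n); apply: leq_addr.
  by apply: Ubounded_le (bY n); apply: leq_addl.
move=> N; have [M hM] := cx N; have [M' hM'] := cy N; exists (maxn M M') => m n.
rewrite !geq_max => /andP[m1 m2] /andP[n1 n2].
rewrite opprD addrACA -scalerBr; apply: span_add; last exact: hM'.
by apply: span_scale; apply: hM.
Qed.

Lemma Ucauchy_add x y : Ucauchy x -> Ucauchy y -> Ucauchy (fun n => x n + y n).
Proof.
move=> cx cy; have := Ucauchy_lin 1 cx cy.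
by congr Ucauchy; apply/funext => n; rewrite scale1r.
Qed.

Lemma Ucauchy_scale c x : Ucauchy x -> Ucauchy (fun n => c *: x n).
Proof.
move=> cx; have := Ucauchy_lin c cx Ucauchy0.
by congr Ucauchy; apply/funext => n; rewrite addr0.
Qed.

Lemma Ucauchy_mul x y : Ucauchy x -> Ucauchy y -> Ucauchy (fun n => x n * y n).
Proof.
case=> -[D bx] cx [[E bY] cy]; split.
  by exists (D + E)%N => n; apply: Ubounded_mul.
move=> N; have [M hM] := cx (N + E)%N; have [M' hM'] := cy N; exists (maxn M M') => m n.
rewrite !geq_max => /andP[m1 m2] /andP[n1 n2].
have -> : x m * y m - x n * y n = x m * (y m - y n) + (x m - x n) * y n.
  by rewrite mulrBr mulrBl addrA subrK.
apply: span_add; first by apply: Ufil_mull; apply: hM'.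
by apply: Ufil_mulr (bY n); apply: hM.
Qed.

Lemma Uideal_add x y : Uideal x -> Uideal y -> Uideal (fun n => x n + y n).
Proof.
move=> ix; elim=> {y} [|y g h u v a b _ IH cg ch|y g h _ IH cg ch].
- by rewrite (_ : (fun n => _) = x) //; apply/funext => n; rewrite addr0.
- rewrite (_ : (fun n => _) = fun n => (x n + y n) + g n * Uborch u v a b n * h n).
    exact: Uideal_borch.
  by apply/funext => n; rewrite addrA.
rewrite (_ : (fun n => _) = fun n => (x n + y n) + g n * Uvac n * h n).
  exact: Uideal_vac.
by apply/funext => n; rewrite addrA.
Qed.

Lemma Uideal_mulr x z : Uideal x -> Ucauchy z -> Uideal (fun n => x n * z n).
Proof.
move=> ix cz; elim: ix => {x} [|y g h u v a b _ IH cg ch|y g h _ IH cg ch].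
- rewrite (_ : (fun n => _) = fun=> 0); first exact: Uideal0.
  by apply/funext => n; rewrite mul0r.
- rewrite (_ : (fun n => _) =
      fun n => y n * z n + g n * Uborch u v a b n * (h n * z n)).
    by apply: Uideal_borch => //; apply: Ucauchy_mul.
  by apply/funext => n; rewrite mulrDl !mulrA.
rewrite (_ : (fun n => _) = fun n => y n * z n + g n * Uvac n * (h n * z n)).
  by apply: Uideal_vac => //; apply: Ucauchy_mul.
by apply/funext => n; rewrite mulrDl !mulrA.
Qed.

Lemma Uideal_mull x z : Uideal x -> Ucauchy z -> Uideal (fun n => z n * x n).
Proof.
move=> ix cz; elim: ix => {x} [|y g h u v a b _ IH cg ch|y g h _ IH cg ch].
- rewrite (_ : (fun n => _) = fun=> 0); first exact: Uideal0.
  by apply/funext => n; rewrite mulr0.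
- rewrite (_ : (fun n => _) =
      fun n => z n * y n + (z n * g n) * Uborch u v a b n * h n).
    by apply: Uideal_borch => //; apply: Ucauchy_mul.
  by apply/funext => n; rewrite mulrDr !mulrA.
rewrite (_ : (fun n => _) = fun n => z n * y n + (z n * g n) * Uvac n * h n).
  by apply: Uideal_vac => //; apply: Ucauchy_mul.
by apply/funext => n; rewrite mulrDr !mulrA.
Qed.

Lemma Uclosure0 : Uclosure (fun=> 0).
Proof.
move=> N; exists (fun=> 0); first exact: Uideal0.
by exists 0%N => n _; rewrite subrr; apply: span_nil.
Qed.

Lemma Uclosure_add x y : Uclosure x -> Uclosure y -> Uclosure (fun n => x n + y n).
Proof.
move=> hx hy N; have [x' ix [M hM]] := hx N; have [y' iy [M' hM']] := hy N.
exists (fun n => x' n + y' n); first exact: Uideal_add.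
exists (maxn M M') => n; rewrite geq_max => /andP[n1 n2].
by rewrite opprD addrACA; apply: span_add; [apply: hM|apply: hM'].
Qed.

Lemma Uclosure_mull x z : Uclosure x -> Ucauchy z -> Uclosure (fun n => z n * x n).
Proof.
move=> hx cz N; have [y iy [M hM]] := hx N.
exists (fun n => z n * y n); first exact: Uideal_mull.
by exists M => n /hM h; rewrite -mulrBr; apply: Ufil_mull.
Qed.

Lemma Uclosure_mulr x z : Uclosure x -> Ucauchy z -> Uclosure (fun n => x n * z n).
Proof.
move=> hx cz N; case: (cz) => -[D bz] _; have [y iy [M hM]] := hx (N + D)%N.
exists (fun n => y n * z n); first exact: Uideal_mulr.
by exists M => n /hM h; rewrite -mulrBl; apply: Ufil_mulr (bz n).
Qed.

Lemma Uclosure_scale c x : Uclosure x -> Uclosure (fun n => c *: x n).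
Proof.
move=> hx; have := Uclosure_mull hx (Ucauchy_scale c Ucauchy1).
by congr Uclosure; apply/funext => n; rewrite -pzalg_scaleAl mul1r.
Qed.

Lemma Uclosure_opp x : Uclosure x -> Uclosure (fun n => - x n).
Proof.
move=> hx; have := Uclosure_scale (-1) hx.
by congr Uclosure; apply/funext => n; rewrite scaleN1r.
Qed.

Record Useq := USeq { useq :> nat -> ULV; useqP : Ucauchy useq }.
HB.instance Definition _ := gen_eqMixin Useq.
HB.instance Definition _ := gen_choiceMixin Useq.

Definition Uequiv (x y : Useq) : bool := `[< Uclosure (fun n => x n - y n) >].

Lemma Uequiv_refl : reflexive Uequiv.
Proof.
move=> x; apply/asboolP; rewrite (_ : (fun n => _) = fun=> 0); first exact: Uclosure0.
by apply/funext => n; rewrite subrr.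
Qed.
Lemma Uequiv_sym : symmetric Uequiv.
Proof.
suff s x y : Uequiv x y -> Uequiv y x by move=> x y; apply/idP/idP; apply: s.
move=> /asboolP /Uclosure_opp h; apply/asboolP; move: h; congr Uclosure.
by apply/funext => n; rewrite opprB.
Qed.
Lemma Uequiv_trans : transitive Uequiv.
Proof.
move=> y x z /asboolP h /asboolP h'; apply/asboolP; move: (Uclosure_add h h').
by congr Uclosure; apply/funext => n; rewrite addrA subrK.
Qed.

Definition Uequiv_rel := EquivRel Uequiv Uequiv_refl Uequiv_sym Uequiv_trans.

Definition Uenv_sort := {eq_quot Uequiv_rel}.
HB.instance Definition _ := Choice.on Uenv_sort.
HB.instance Definition _ := EqQuotient.on Uenv_sort.

Lemma Uenv_eq (x y : Useq) :
  \pi_Uenv_sort x = \pi_Uenv_sort y <-> Uclosure (fun n => x n - y n).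
Proof.
split=> [/eqmodP/asboolP //|h]; first by apply/eqmodP/asboolP.
Qed.

Lemma Uenv_repr (x : Useq) : Uclosure (fun n => repr (\pi_Uenv_sort x) n - x n).
Proof. by apply/Uenv_eq; rewrite reprK. Qed.

Definition s0 : Useq := USeq Ucauchy0.
Definition s1 : Useq := USeq Ucauchy1.
Definition sadd (x y : Useq) : Useq := USeq (Ucauchy_add (useqP x) (useqP y)).
Definition smul (x y : Useq) : Useq := USeq (Ucauchy_mul (useqP x) (useqP y)).
Definition sscale c (x : Useq) : Useq := USeq (Ucauchy_scale c (useqP x)).

Definition Uadd (x y : Uenv_sort) : Uenv_sort := \pi_Uenv_sort (sadd (repr x) (repr y)).
Definition Umul (x y : Uenv_sort) : Uenv_sort := \pi_Uenv_sort (smul (repr x) (repr y)).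
Definition Uscale c (x : Uenv_sort) : Uenv_sort := \pi_Uenv_sort (sscale c (repr x)).
Definition Uopp := Uscale (-1).
Definition Uzero : Uenv_sort := \pi_Uenv_sort s0.
Definition Uone : Uenv_sort := \pi_Uenv_sort s1.

Lemma Uadd_pi x y : Uadd (\pi_Uenv_sort x) (\pi_Uenv_sort y) = \pi_Uenv_sort (sadd x y).
Proof.
apply/Uenv_eq; move: (Uclosure_add (Uenv_repr x) (Uenv_repr y)).
by congr Uclosure; apply/funext => n /=; rewrite opprD addrACA.
Qed.

Lemma Umul_pi x y : Umul (\pi_Uenv_sort x) (\pi_Uenv_sort y) = \pi_Uenv_sort (smul x y).
Proof.
apply/Uenv_eq; set x' := repr _; set y' := repr _.
have h1 := Uclosure_mull (Uenv_repr y : Uclosure (fun n => y' n - y n)) (useqP x').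
have h2 := Uclosure_mulr (Uenv_repr x : Uclosure (fun n => x' n - x n)) (useqP y).
move: (Uclosure_add h1 h2); congr Uclosure; apply/funext => n /=.
by rewrite mulrBr mulrBl addrA subrK.
Qed.

Lemma Uscale_pi c x : Uscale c (\pi_Uenv_sort x) = \pi_Uenv_sort (sscale c x).
Proof.
apply/Uenv_eq; move: (Uclosure_scale c (Uenv_repr x)).
by congr Uclosure; apply/funext => n /=; rewrite scalerBr.
Qed.

Lemma Useq_eq (x y : Useq) : (forall n, x n = y n) -> \pi_Uenv_sort x = \pi_Uenv_sort y.
Proof.
move=> xy; apply/Uenv_eq; rewrite (_ : (fun n => _) = fun=> 0); first exact: Uclosure0.
by apply/funext => n; rewrite xy subrr.
Qed.

Lemma Uenv_ind (P : Uenv_sort -> Prop) : (forall x, P (\pi_Uenv_sort x)) -> forall x, P x.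
Proof. by move=> h x; rewrite -[x]reprK. Qed.

Let UE := (Uadd_pi, Umul_pi, Uscale_pi).

Fact UaddA : associative Uadd.
Proof.
do 3!elim/Uenv_ind => ?; rewrite !UE; apply: Useq_eq => n /=; exact: addrA.
Qed.
Fact UaddC : commutative Uadd.
Proof. by do 2!elim/Uenv_ind => ?; rewrite !UE; apply: Useq_eq => n /=; apply: addrC. Qed.
Fact Uadd0 : left_id Uzero Uadd.
Proof. by elim/Uenv_ind => ?; rewrite !UE; apply: Useq_eq => n /=; apply: add0r. Qed.
Fact UaddN : left_inverse Uzero Uopp Uadd.
Proof.
elim/Uenv_ind => ?; rewrite /Uopp !UE; apply: Useq_eq => n /=.
by rewrite scaleN1r addNr.
Qed.
HB.instance Definition _ := GRing.isZmodule.Build Uenv_sort UaddA UaddC Uadd0 UaddN.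

Fact UmulA : associative Umul.
Proof. by do 3!elim/Uenv_ind => ?; rewrite !UE; apply: Useq_eq => n /=; apply: mulrA. Qed.
Fact Umul1 : left_id Uone Umul.
Proof. by elim/Uenv_ind => ?; rewrite !UE; apply: Useq_eq => n /=; apply: mul1r. Qed.
Fact Umulr1 : right_id Uone Umul.
Proof. by elim/Uenv_ind => ?; rewrite !UE; apply: Useq_eq => n /=; apply: mulr1. Qed.
Fact UmulDl : left_distributive Umul Uadd.
Proof. by do 3!elim/Uenv_ind => ?; rewrite !UE; apply: Useq_eq => n /=; apply: mulrDl. Qed.
Fact UmulDr : right_distributive Umul Uadd.
Proof. by do 3!elim/Uenv_ind => ?; rewrite !UE; apply: Useq_eq => n /=; apply: mulrDr. Qed.
HB.instance Definition _ :=
  GRing.Zmodule_isPzRing.Build Uenv_sort UmulA Umul1 Umulr1 UmulDl UmulDr.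

Fact UscaleA c d x : Uscale c (Uscale d x) = Uscale (c * d) x.
Proof. by elim/Uenv_ind: x => ?; rewrite !UE; apply: Useq_eq => n /=; apply: scalerA. Qed.
Fact Uscale1 : left_id 1 Uscale.
Proof. by elim/Uenv_ind => ?; rewrite !UE; apply: Useq_eq => n /=; apply: scale1r. Qed.
Fact UscaleDr : right_distributive Uscale +%R.
Proof.
move=> c; elim/Uenv_ind => x; elim/Uenv_ind => y.
rewrite -[LHS]/(Uscale c (Uadd _ _)) -[RHS]/(Uadd _ _) !UE; apply: Useq_eq => n /=.
exact: scalerDr.
Qed.
Fact UscaleDl x : {morph Uscale^~ x : c d / c + d}.
Proof.
elim/Uenv_ind: x => x c d; rewrite -[RHS]/(Uadd _ _) !UE; apply: Useq_eq => n /=.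
exact: scalerDl.
Qed.
Fact UscaleMl c x y : Uscale c (x * y) = Uscale c x * y.
Proof.
elim/Uenv_ind: x => x; elim/Uenv_ind: y => y.
rewrite -[LHS]/(Uscale c (Umul _ _)) -[RHS]/(Umul _ _) !UE.
by apply: Useq_eq => n /=; apply: pzalg_scaleAl.
Qed.
Fact UscaleMr c x y : Uscale c (x * y) = x * Uscale c y.
Proof.
elim/Uenv_ind: x => x; elim/Uenv_ind: y => y.
rewrite -[LHS]/(Uscale c (Umul _ _)) -[RHS]/(Umul _ _) !UE.
by apply: Useq_eq => n /=; apply: pzalg_scaleAr.
Qed.

Definition Uenv : pzAlgType F :=
  PzAlg UscaleA Uscale1 UscaleDr UscaleDl UscaleMl UscaleMr.

Definition mode (u : V) (a : int) : Uenv := \pi_Uenv_sort (USeq (Ucauchy_lmode u a)).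

(* Convergence in Uenv: its neighbourhoods of 0 are the images of the closures of
   the [Ufil N]. *)
Definition Usmall (N : nat) (z : Uenv) : Prop :=
  exists2 x : Useq, z = \pi_Uenv_sort x & forall n, Ufil N (x n).
Definition Ulim (z : nat -> Uenv) (w : Uenv) : Prop :=
  forall N, exists M, forall n, (M <= n)%N -> Usmall N (z n - w).

(* The topology is separated, so limits are unique. *)
Lemma Usmall_eq0 (z : Uenv) : (forall N, Usmall N z) -> z = 0.
Proof.
elim/Uenv_ind: z => x hx; apply/Uenv_eq => N; have [x' /Uenv_eq e fx'] := hx N.
have [y iy [M hM]] := e N; exists y => //; exists M => n /hM h.
have := span_add h (fx' n); congr (span _ _).
by rewrite /= subr0 addrAC subrK.
Qed.

End EnvelopingAlgebra.

Section Functoriality.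
Variables (F : numFieldType) (V W : valg F) (f : V -> W).
Hypothesis mf : va_morphism f.

Lemma vmorph0 : f 0 = 0.
Proof.
have := vm_lin mf (-1) 0 0; rewrite scaler0 addr0 scaleN1r => h.
by rewrite h addNr.
Qed.

Fact ULV_map_rel : LV_rel (fun x : V * int => lmode (f x.1) x.2).
Proof.
have R := ULV_rel W; split=> [c u v a|u a|u v a b M hM] /=.
- by rewrite (vm_lin mf) lmode_lin.
- by rewrite (vm_prd mf) (vm_vac mf); apply: (LV_der R).
rewrite [LHS](LV_comm R _ _ (M := M)) => [|r /hM h].
  by apply: eq_bigr => r _; rewrite (vm_prd mf).
by rewrite -(vm_prd mf) h vmorph0.
Qed.

Definition ULV_map : ULV V -> ULV W := plift (fun x : V * int => lmode (f x.1) x.2).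

Lemma ULV_map_lmode u a : ULV_map (lmode u a) = lmode (f u) a.
Proof. exact: (plift_gen _ ULV_map_rel). Qed.
Lemma ULV_map1 : ULV_map 1 = 1.
Proof. by case: (plift_morph ULV_map_rel). Qed.
Lemma ULV_mapM x y : ULV_map (x * y) = ULV_map x * ULV_map y.
Proof. by case: (plift_morph ULV_map_rel). Qed.
Lemma ULV_map_lin c x y : ULV_map (c *: x + y) = c *: ULV_map x + ULV_map y.
Proof. by case: (plift_morph ULV_map_rel) => _ _; apply. Qed.
Lemma ULV_map0 : ULV_map 0 = 0.
Proof.
by have := ULV_map_lin (-1) 0 0; rewrite scaler0 addr0 scaleN1r addNr.
Qed.
Lemma ULV_mapD x y : ULV_map (x + y) = ULV_map x + ULV_map y.
Proof. by rewrite -[x]scale1r ULV_map_lin !scale1r. Qed.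
Lemma ULV_mapZ c x : ULV_map (c *: x) = c *: ULV_map x.
Proof. by rewrite -[c *: x]addr0 ULV_map_lin ULV_map0 addr0. Qed.
Lemma ULV_mapB x y : ULV_map (x - y) = ULV_map x - ULV_map y.
Proof. by rewrite addrC -scaleN1r ULV_map_lin scaleN1r addrC. Qed.
Lemma ULV_map_sum I (r : seq I) (g : I -> ULV V) :
  ULV_map (\sum_(i <- r) g i) = \sum_(i <- r) ULV_map (g i).
Proof. by apply: big_morph => [x y|]; rewrite ?ULV_mapD ?ULV_map0. Qed.

Lemma ULV_map_mono d x : mono d x -> mono d (ULV_map x).
Proof.
elim=> {d x} [|d p u a e x hu _ IH]; first by rewrite ULV_map1; constructor.
by rewrite ULV_mapM ULV_map_lmode; apply: mono_mul IH; apply: (vm_hom mf) hu.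
Qed.

Lemma ULV_map_bounded D x : Ubounded D x -> Ubounded D (ULV_map x).
Proof.
apply: span_map => [c s t|s [d [dD ms]]]; first exact: ULV_map_lin.
by apply: span_inc; exists d; split=> //; apply: ULV_map_mono.
Qed.

Lemma ULV_map_fil N x : Ufil N x -> Ufil N (ULV_map x).
Proof.
apply: span_map => [c s t|s [y [d [z [dN mz ->]]]]]; first exact: ULV_map_lin.
apply: span_inc; exists (ULV_map y), d, (ULV_map z); rewrite ULV_mapM; split=> //.
exact: ULV_map_mono.
Qed.

Lemma ULV_map_cauchy x : Ucauchy x -> Ucauchy (fun n => ULV_map (x n)).
Proof.
case=> -[D bx] cx; split; first by exists D => n; apply: ULV_map_bounded.
move=> N; have [M hM] := cx N; exists M => m n m1 n1.
by rewrite -ULV_mapB; apply: ULV_map_fil; apply: hM.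
Qed.

Lemma ULV_map_ideal x : Uideal x -> Uideal (fun n => ULV_map (x n)).
Proof.
elim=> {x} [|y g h u v a b _ IH cg ch|y g h _ IH cg ch].
- rewrite (_ : (fun n => _) = fun=> 0); first exact: Uideal0.
  by apply/funext => n; rewrite ULV_map0.
- rewrite (_ : (fun n => _) = fun n => ULV_map (y n)
      + ULV_map (g n) * Uborch (f u) (f v) a b n * ULV_map (h n)).
    by apply: Uideal_borch => //; apply: ULV_map_cauchy.
  apply/funext => n; rewrite ULV_mapD !ULV_mapM; congr (_ + _ * _ * _).
  rewrite /Uborch ULV_mapB ULV_map_sum ULV_map_lmode (vm_prd mf); congr (_ - _).
  apply: eq_bigr => i _; rewrite ULV_mapZ ULV_mapB ULV_mapZ !ULV_mapM.
  by rewrite !ULV_map_lmode.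
rewrite (_ : (fun n => _) = fun n => ULV_map (y n)
    + ULV_map (g n) * Uvac W n * ULV_map (h n)).
  by apply: Uideal_vac => //; apply: ULV_map_cauchy.
apply/funext => n; rewrite ULV_mapD !ULV_mapM; congr (_ + _ * _ * _).
by rewrite /Uvac ULV_mapB ULV_map1 ULV_map_lmode (vm_vac mf).
Qed.

Lemma ULV_map_closure x : Uclosure x -> Uclosure (fun n => ULV_map (x n)).
Proof.
move=> hx N; have [y iy [M hM]] := hx N; exists (fun n => ULV_map (y n)).
  exact: ULV_map_ideal.
by exists M => n /hM h; rewrite -ULV_mapB; apply: ULV_map_fil.
Qed.

Definition Useq_map (x : Useq V) : Useq W := USeq (ULV_map_cauchy (useqP x)).

Definition Uenv_map (x : Uenv V) : Uenv W := \pi_(Uenv_sort W) (Useq_map (repr x)).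

Lemma Uenv_map_pi (x : Useq V) :
  Uenv_map (\pi_(Uenv_sort V) x) = \pi_(Uenv_sort W) (Useq_map x).
Proof.
apply/Uenv_eq; move: (ULV_map_closure (Uenv_repr x)); congr Uclosure.
by apply/funext => n /=; rewrite ULV_mapB.
Qed.

Lemma Uenv_map_mode u a : Uenv_map (mode u a) = mode (f u) a.
Proof. by rewrite /mode Uenv_map_pi; apply: Useq_eq => n /=; rewrite ULV_map_lmode. Qed.

Lemma Uenv_map_morph : alg_morphism Uenv_map.
Proof.
split.
- rewrite [LHS]Uenv_map_pi; apply: Useq_eq => n /=; exact: ULV_map1.
- elim/Uenv_ind => x; elim/Uenv_ind => y.
  rewrite -[LHS]/(Uenv_map (Umul _ _)) -[RHS]/(Umul _ _) !(Uenv_map_pi, Umul_pi).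
  by apply: Useq_eq => n /=; apply: ULV_mapM.
move=> c; elim/Uenv_ind => x; elim/Uenv_ind => y.
rewrite -[LHS]/(Uenv_map (Uadd (Uscale c _) _)) -[RHS]/(Uadd (Uscale c _) _).
rewrite !(Uenv_map_pi, Uscale_pi, Uadd_pi); apply: Useq_eq => n /=.
exact: ULV_map_lin.
Qed.

End Functoriality.

Section AffineYangian.
Variables (F : numFieldType) (n : nat) (hbar eps : F).

(* [YX s i r] is X^+_{i,r} or X^-_{i,r} according to whether [s] is true or
   false, and [YH i r] is H_{i,r}; [r = false] stands for 0, [r = true] for 1.
   The elements of Z/nZ are represented by 0, ..., n-1. *)
Inductive Ygen :=
| YX of bool & 'I_n & bool
| YH of 'I_n & bool.

Definition cartan (i j : 'I_n) : int :=
  if i == j then 2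
  else if (i.+1 %% n == j)%N || (j.+1 %% n == i)%N then -1 else 0.

(* (i, j) is (0, n-1) *)
Definition wrap (i j : 'I_n) : bool := ((i : nat) == 0%N) && (j.+1 == n).

Definition sg (s : bool) : F := if s then 1 else -1.

Definition acomm (A : pzRingType) (x y : A) : A := x * y + y * x.

Record Y_rel (A : pzAlgType F) (m : Ygen -> A) : Prop := {
  Y_HH : forall i r j s, comm (m (YH i r)) (m (YH j s)) = 0;
  Y_XX00 : forall i j, comm (m (YX true i false)) (m (YX false j false)) =
    if i == j then m (YH i false) else 0;
  Y_XX10 : forall i j, comm (m (YX true i true)) (m (YX false j false)) =
    if i == j then m (YH i true) else 0;
  Y_XX01 : forall i j, comm (m (YX true i false)) (m (YX false j true)) =
    if i == j then m (YH i true) else 0;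
  Y_H0X : forall s i j r, comm (m (YH i false)) (m (YX s j r)) =
    (sg s * (cartan i j)%:~R) *: m (YX s j r);
  Y_H1X : forall s i j, ~~ wrap i j -> ~~ wrap j i ->
    comm (m (YH i true) - (hbar / 2) *: m (YH i false) ^+ 2) (m (YX s j false)) =
    (sg s * (cartan i j)%:~R) *: m (YX s j true);
  Y_H1X_wrap : forall s i j, wrap i j ->
    comm (m (YH i true) - (hbar / 2) *: m (YH i false) ^+ 2) (m (YX s j false)) =
    - sg s *: (m (YX s j true) + (eps + n%:R / 2 * hbar) *: m (YX s j false));
  Y_H1X_wrap' : forall s i j, wrap j i ->
    comm (m (YH i true) - (hbar / 2) *: m (YH i false) ^+ 2) (m (YX s j false)) =
    - sg s *: (m (YX s j true) - (eps + n%:R / 2 * hbar) *: m (YX s j false));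
  Y_XX : forall s i j, ~~ wrap i j -> ~~ wrap j i ->
    comm (m (YX s i true)) (m (YX s j false)) - comm (m (YX s i false)) (m (YX s j true)) =
    (sg s * (cartan i j)%:~R * (hbar / 2)) *: acomm (m (YX s i false)) (m (YX s j false));
  Y_XX_wrap : forall s i j, wrap i j ->
    comm (m (YX s i true)) (m (YX s j false)) - comm (m (YX s i false)) (m (YX s j true)) =
    - (sg s * (hbar / 2)) *: acomm (m (YX s i false)) (m (YX s j false))
    + (eps + n%:R / 2 * hbar) *: comm (m (YX s i false)) (m (YX s j false));
  Y_Serre : forall s i j, i != j ->
    iter (1 + `|cartan i j|) (comm (m (YX s i false))) (m (YX s j false)) = 0
}.

Definition Yangian : pzAlgType F := palg Y_rel.
Definition Ygenerator (x : Ygen) : Yangian := pgen Y_rel x.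

Lemma Yangian_rel : Y_rel Ygenerator.
Proof.
have E (A : pzAlgType F) (m : Ygen -> A) : Y_rel m ->
  [/\ forall x, plift m (Ygenerator x) = m x,
      forall x y : Yangian, plift m (x * y) = plift m x * plift m y,
      forall x y : Yangian, plift m (x + y) = plift m x + plift m y &
      forall c (x : Yangian), plift m (c *: x) = c *: plift m x].
  by move=> r; split=> *; [apply: plift_gen|apply: pliftME|apply: pliftDE|apply: pliftZE].
have E' (A : pzAlgType F) (m : Ygen -> A) (r : Y_rel m) :
  [/\ forall x : Yangian, plift m (- x) = - plift m x, plift m (0 : Yangian) = 0 &
      forall x y : Yangian, plift m (comm x y) = comm (plift m x) (plift m y)].
  have [_ eM eD eZ] := E _ _ r.
  have eN (x : Yangian) : plift m (- x) = - plift m x by rewrite -scaleN1r eZ scaleN1r.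
  by split=> // [|x y]; [apply: plift0E|rewrite /comm eD eN !eM].
have iterE (A : pzAlgType F) (m : Ygen -> A) (r : Y_rel m) k (x y : Yangian) :
    plift m (iter k (comm x) y) = iter k (comm (plift m x)) (plift m y).
  by have [_ _ eC] := E' _ _ r; elim: k => //= k <-.
split; last first.
  move=> s i j ij; apply: palg_eq => A m r; rewrite iterE //.
  by have [e1 _ _ _] := E _ _ r; have [_ -> _] := E' _ _ r; rewrite !e1; apply: (Y_Serre r).
all: move=> *; apply: palg_eq => A m r; have [e1 e2 e3 e4] := E _ _ r;
  have [e5 e6 e7] := E' _ _ r;
  rewrite ?expr2 /acomm ?(e7, e5, e6, e3, e2, e4, e1) -?expr2.
- exact: (Y_XX_wrap r).
- exact: (Y_XX r).
- exact: (Y_H1X_wrap' r).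
- exact: (Y_H1X_wrap r).
- exact: (Y_H1X r).
- exact: (Y_H0X r).
- by rewrite (Y_XX01 r); case: ifP.
- by rewrite (Y_XX10 r); case: ifP.
- by rewrite (Y_XX00 r); case: ifP.
exact: (Y_HH r).
Qed.

End AffineYangian.

Section Phi.
Variables (F : numFieldType) (q : seq nat) (k hbar eps : F) (a : nat).

Let d := (nval q 1 - nval q a)%N.
Let n := (nval q a - nval q a.+1)%N.
Local Notation W := (walg q k).

(* Partial sums of the right-hand side of the formula for Phi_a(H_{i,1}); the sums
   over s >= 0 run over s < S. *)
Definition PhiH (w1 w2 : nat -> nat -> W) (i S : nat) : Uenv W :=
  let W1t p r b := mode (w1 (d + p)%N (d + r)%N) b in
  let W2t p r b := mode (w2 (d + p)%N (d + r)%N) b in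
  - hbar *: (W2t i i 1 - W2t i.+1 i.+1 1)
  - (i%:R / 2 * hbar) *: (W1t i i 0 - W1t i.+1 i.+1 0)
  - hbar *: (W1t i i 0 * W1t i.+1 i.+1 0)
  + hbar *: (\sum_(0 <= s < S) \sum_(1 <= u < i.+1)
               W1t i u (- s%:Z) * W1t u i s%:Z)
  + hbar *: (\sum_(0 <= s < S) \sum_(i.+1 <= u < n.+1)
               W1t i u (- s%:Z - 1) * W1t u i (s%:Z + 1))
  - hbar *: (\sum_(0 <= s < S) \sum_(1 <= u < i.+1)
               W1t i.+1 u (- s%:Z) * W1t u i.+1 s%:Z)
  - hbar *: (\sum_(0 <= s < S) \sum_(i.+1 <= u < n.+1)
               W1t i.+1 u (- s%:Z - 1) * W1t u i.+1 (s%:Z + 1)).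

Definition is_Phi
    (Phi : Yangian n hbar (eps - ((nval q a)%:R - (qpart q (size q))%:R) * hbar) -> Uenv W) : Prop :=
  let X s i := Phi (Ygenerator _ _ (YX s i false)) in
  let H1 i := Phi (Ygenerator _ _ (YH i true)) in
  alg_morphism Phi /\
  exists w1 w2 : nat -> nat -> W,
    [/\ forall p r, (d < p <= d + n)%N -> (d < r <= d + n)%N ->
          val (w1 p r) = W1 q k p r /\ val (w2 p r) = W2 q k a p r,
        forall i : 'I_n, i = 0%N :> nat ->
          X true i = mode (w1 (d + n)%N d.+1) 1 /\ X false i = mode (w1 d.+1 (d + n)%N) (-1),
        forall i : 'I_n, (0 < i)%N ->
          X true i = mode (w1 (d + i)%N (d + i).+1) 0 /\
          X false i = mode (w1 (d + i).+1 (d + i)%N) 0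
      & forall i : 'I_n, (0 < i)%N -> Ulim (PhiH w1 w2 i) (H1 i)].

End Phi.

Definition coset_incl (F : numFieldType) (q : seq nat) (k : F) :
    va_morphism (val : walg_coset q k -> walg q k) :=
  subva_incl _.

(* Main.v *)
Require Import Defs.
From mathcomp Require Import all_boot all_order all_algebra.
From mathcomp Require Import reals complex.
From mathcomp Require Import generic_quotient boolp zify.


(* Put h = n_1 - n_2.  As b_1 = 1, the rows 1, ..., h meet only the first column, so
   W^(1)_{i,j} = E^(1)_{i,j}[-1] for i, j <= h.  A current E_{i,j} with i, j <= h has a
   bracket only with matrix units having an index <= h.  The currents W^(1)_{p,r} with
   p, r > h involve no such units, and pair with E_{i,j} only through a multiple of
   delta_{i,j}; hence they commute with sl(h).  In W^(2)_{p,p} the only other terms are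
   - sum_{u <= h} E_{u,p}[-1] E_{p,u}[-1] in the first column; its products with E_{i,j}
   are multiples of delta_{i,j}, except for a first order pole - E_{i,j} which does not
   depend on p.  Hence the differences W^(2)_{p,p} - W^(2)_{r,r}, which are all that
   occurs in Phi_a, lie in the coset.  The infinite sums in Phi_a(H_{i,1}) converge in
   the completion attached to the coset, and the X_{i,0} and the H_{j,1} with j > 0
   generate the Yangian. *)

Set Implicit Arguments.
Unset Strict Implicit.
Unset Printing Implicit Defensive.

Import Order.TTheory GRing.Theory Num.Theory.
Local Open Scope ring_scope.
Local Open Scope quotient_scope.

(** * Borcherds' identity for arbitrary vectors and its consequences *)

Lemma scaler_lin_sub (F : comPzRingType) (V : lmodType F) (g x s : F) (p1 p2 r1 r2 : V) :
  g *: (x *: p1 + p2 - s *: (x *: r1 + r2)) =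
  x *: (g *: (p1 - s *: r1)) + g *: (p2 - s *: r2).
Proof.
rewrite (scalerDr s) opprD addrACA scalerDr; congr (_ + _).
by rewrite scalerA [s * x]mulrC -scalerA -scalerBr !scalerA mulrC.
Qed.

(** The axiom concerns homogeneous vectors. Both sides are bilinear in [a] and [b], and odd vectors
    vanish in a [valg], so the identity extends to all vectors without parity signs. The bound [M0]
    grows with the decompositions of [a] and [b]. *)
Lemma borcherds (F : numFieldType) (V : valg F) (a b c : V) (l m n : int) :
  exists M0, forall M, (M0 <= M)%N ->
    \sum_(j < M) gbin F m j *: prd (m + n - j%:Z) (prd (l + j%:Z) a b) c =
    \sum_(j < M) ((-1) ^+ j * gbin F l j) *:
      (prd (m + l - j%:Z) a (prd (n + j%:Z) b c)
       - (-1) ^ l *: prd (n + l - j%:Z) b (prd (m + j%:Z) a c)).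
Proof.
have ax := vs_axioms V.
pose lhs a b M := \sum_(j < M) gbin F m j *: prd (m + n - j%:Z) (prd (l + j%:Z) a b) c.
pose rhs a b M := \sum_(j < M) ((-1) ^+ j * gbin F l j) *:
  (prd (m + l - j%:Z) a (prd (n + j%:Z) b c)
   - (-1) ^ l *: prd (n + l - j%:Z) b (prd (m + j%:Z) a c)).
have lhsl x a1 a2 b0 M : lhs (x *: a1 + a2) b0 M = x *: lhs a1 b0 M + lhs a2 b0 M.
  rewrite scaler_sumr -big_split; apply: eq_bigr => j _ /=.
  by rewrite !(va_linl ax) scalerDr !scalerA [_ * x]mulrC.
have lhsr x a0 b1 b2 M : lhs a0 (x *: b1 + b2) M = x *: lhs a0 b1 M + lhs a0 b2 M.
  rewrite scaler_sumr -big_split; apply: eq_bigr => j _ /=.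
  by rewrite (va_linr ax) (va_linl ax) scalerDr !scalerA [_ * x]mulrC.
have rhsl x a1 a2 b0 M : rhs (x *: a1 + a2) b0 M = x *: rhs a1 b0 M + rhs a2 b0 M.
  rewrite scaler_sumr -big_split; apply: eq_bigr => j _ /=.
  by rewrite !(va_linl ax) (va_linr ax) scaler_lin_sub.
have rhsr x a0 b1 b2 M : rhs a0 (x *: b1 + b2) M = x *: rhs a0 b1 M + rhs a0 b2 M.
  rewrite scaler_sumr -big_split; apply: eq_bigr => j _ /=.
  by rewrite !(va_linl ax) (va_linr ax) scaler_lin_sub.
have lin0 (f : V -> V) : (forall x u v, f (x *: u + v) = x *: f u + f v) -> f 0 = 0.
  by move/(_ (-1) 0 0); rewrite scaler0 addr0 scaleN1r addNr.
rewrite -/(lhs a b) -/(rhs a b).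
suff [M0 E] : exists M0, forall M, (M0 <= M)%N -> lhs a b M = rhs a b M by exists M0.
elim: (va_hom_span ax a) => [|x a1 a2 [d [p ha1]] _ [M1 IH1]].
  by exists 0%N => M _; rewrite (lin0 (lhs^~ b^~ M)) // (lin0 (rhs^~ b^~ M)).
case: p ha1 => [/va_even->|ha1]; first by exists M1 => M; rewrite scaler0 add0r; apply: IH1.
suff [M2 E] : exists M2, forall M, (M2 <= M)%N -> lhs a1 b M = rhs a1 b M.
  exists (maxn M1 M2) => M; rewrite geq_max => /andP[/IH1 e1 /E e2].
  by rewrite lhsl rhsl e1 e2.
elim: (va_hom_span ax b) => [|y b1 b2 [e [r hb1]] _ [M2 IH2]].
  by exists 0%N => M _; rewrite (lin0 (lhs a1 ^~ M)) // (lin0 (rhs a1 ^~ M)).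
case: r hb1 => [/va_even->|hb1]; first by exists M2 => M; rewrite scaler0 add0r; apply: IH2.
have [N1 H1] := prd_trunc a1 b1; have [N2 H2] := prd_trunc b1 c; have [N3 H3] := prd_trunc a1 c.
exists (maxn M2 (`|N1| + `|N2| + `|N3| + `|n| + `|m| + `|l|)%N) => M.
rewrite geq_max => /andP[/IH2 e2 hM]; rewrite lhsr rhsr e2; congr (_ *: _ + _).
have := va_borcherds ax (l := l) (m := m) (n := n) (M := M) (c := c) ha1 hb1.
rewrite mulr1; apply => j hj.
by split; [apply: H1|apply: H2|apply: H3]; lia.
Qed.

Lemma gbin_small (F : numFieldType) (m j : nat) : (m < j)%N -> gbin F m%:Z j = 0.
Proof. by move=> mj; rewrite /gbin (bigD1 (Ordinal mj)) //= subrr mulr0z !mul0r. Qed.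

Lemma gbin_nat0 (F : numFieldType) (m : nat) : gbin F m%:Z 0 = 1.
Proof. by rewrite /gbin big_ord0 fact0 divr1. Qed.

Lemma sum_gbin (F : numFieldType) (V : lmodType F) (m M : nat) (f : nat -> V) : (m < M)%N ->
  \sum_(j < M) gbin F m%:Z j *: f j = \sum_(j < m.+1) gbin F m%:Z j *: f j.
Proof.
move=> mM; rewrite -!(big_mkord predT (fun j => gbin F m%:Z j *: f j)).
rewrite (big_cat_nat (n := m.+1)) //= [X in _ + X]big_nat_cond [X in _ + X]big1 ?addr0 //.
by move=> j /andP[/andP[h _] _]; rewrite gbin_small // scale0r.
Qed.

(** Borcherds' identity with l = 0, where only the summand j = 0 survives on the right. *)
Lemma prd_commutator (F : numFieldType) (V : valg F) (a b c : V) (m : nat) (n : int) :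
  prd m%:Z a (prd n b c) = prd n b (prd m%:Z a c)
    + \sum_(j < m.+1) gbin F m%:Z j *: prd (m%:Z + n - j%:Z) (prd j%:Z a b) c.
Proof.
have [M0 /(_ (maxn M0 m.+1) (leq_maxl _ _))] := borcherds a b c 0 m%:Z n.
rewrite (sum_gbin (fun j : nat => prd (m%:Z + n - j%:Z) (prd (0 + j%:Z) a b) c)) ?leq_maxr //.
under eq_bigr do rewrite add0r.
under [RHS]eq_bigr do rewrite mulrC -scalerA.
rewrite (sum_gbin (m := 0) (fun j : nat => (-1) ^+ j *:
  (prd (m%:Z + 0 - j%:Z) a (prd (n + j%:Z) b c)
   - (-1) ^ (0 : int) *: prd (n + 0 - j%:Z) b (prd (m%:Z + j%:Z) a c)))); last first.
  by rewrite (leq_trans _ (leq_maxr _ _)).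
rewrite big_ord1 gbin0 /= expr0 !scale1r => ->.
by rewrite !(addr0, subr0) addrC subrK.
Qed.

(** Borcherds' identity with m = 0 expresses (u_(n) w)_(r) v, for r >= 0, by terms in which a
    nonnegative mode of u or w hits v first. So commutation need only be checked on generators. *)
Lemma coset_vgen (F : numFieldType) (V : valg F) (S : V -> Prop) (v : V) :
  coset_set S v -> coset_set (vgen S) v.
Proof.
move=> Sv w r gw; elim: gw r => {w} [u /Sv|r|c u w _ IHu _ IHw r|n u w _ IHu _ IHw r] //.
- by rewrite (va_vacl (vs_axioms V)).
- by rewrite (va_linl (vs_axioms V)) IHu IHw scaler0 addr0.
have [M0 /(_ M0.+1 (leqnSn _))] := borcherds u w v n 0 r%:Z.
rewrite (sum_gbin (m := 0) (fun j : nat => prd (0 + r%:Z - j%:Z) (prd (n + j%:Z) u w) v)) //.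
rewrite big_ord1 gbin0 scale1r add0r /= subr0 addr0 => ->.
by rewrite big1 // => j _; rewrite -PoszD IHw add0r IHu !prd0r scaler0 subr0 scaler0.
Qed.

(** * Column heights when b_1 = 1 *)

Section PartitionData.
Variable q : seq nat.
Hypotheses (q_sorted : sorted geq q) (b1 : bval q 1 = 1%N).

Lemma undup_sorted : sorted geq (undup q).
Proof. by apply: (subseq_sorted _ (undup_subseq q) q_sorted) => x y z /= xy zx; apply: leq_trans zx xy. Qed.

Lemma nval_anti a b : (0 < a <= b)%N -> (nval q b <= nval q a)%N.
Proof.
move=> /andP[a0 ab]; rewrite /nval.
have [hb|hb] := ltnP b.-1 (size (undup q)); last by rewrite nth_default.
have tr : transitive geq by move=> x y z /= xy zx; apply: leq_trans zx xy.
have := sorted_leq_nth tr leqnn 0%N undup_sorted.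
have ab' : (a.-1 <= b.-1)%N by rewrite -!subn1 leq_sub2r.
by move/(_ a.-1 b.-1); rewrite !inE /=; apply=> //; apply: leq_ltn_trans hb.
Qed.

Lemma qpart_le s : (qpart q s <= qpart q 1)%N.
Proof.
have [hs|hs] := ltnP s.-1 (size q); last by rewrite /qpart nth_default.
have tr : transitive geq by move=> x y z /= xy zx; apply: leq_trans zx xy.
have := sorted_leq_nth tr leqnn 0%N q_sorted.
by move/(_ 0%N s.-1); rewrite !inE /=; apply=> //; apply: leq_ltn_trans hs.
Qed.

Lemma nval1E : nval q 1 = qpart q 1.
Proof.
(* The empty partition is excluded since its [bval] is 0. *)
have qne : (0 < size q)%N by case: q b1.
have une : (0 < size (undup q))%N.
  by rewrite lt0n size_eq0; apply: contraTneq (mem_nth 0%N qne) => u0; rewrite -mem_undup u0.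
apply/eqP; rewrite eqn_leq; apply/andP; split.
  have: nval q 1 \in q by rewrite -mem_undup mem_nth.
  by move/(nthP 0%N) => [i _ <-]; apply: (qpart_le i.+1).
have: qpart q 1 \in undup q by rewrite mem_undup mem_nth.
by move/(nthP 0%N) => [i _ <-]; apply: (@nval_anti 1 i.+1).
Qed.

(** A second part equal to q_1 would make b_1 at least 2, and every other distinct value is at most
    n_2. Beyond the length of [q] the part is 0 by default. *)
Lemma qpart_le_nval2 s : (1 < s)%N -> (qpart q s <= nval q 2)%N.
Proof.
move=> s1; have [hs|hs] := ltnP s.-1 (size q); last by rewrite /qpart nth_default.
have: qpart q s \in undup q by rewrite mem_undup mem_nth.
move/(nthP 0%N) => [[|c] _ cE]; last by rewrite -cE; apply: (@nval_anti 2 c.+2).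
move: b1; rewrite /bval nval1E; move: cE; rewrite -/(nval q 1) nval1E => eqs.
have {eqs}: qpart q 1 \in behead q.
  by rewrite eqs /qpart; case: s s1 hs {eqs} => [|[|s]] // _; case: q => //= x t; apply: mem_nth.
rewrite /qpart; case: q => //= x t xt; rewrite leqnn add1n => -[] /eqP.
by rewrite -leqn0 leqNgt -has_count => /hasP[]; exists x.
Qed.

End PartitionData.

(** * Nonnegative products of matrix units *)

Section AffineOPE.
Variables (F : numFieldType) (P : rel nat) (form : nat -> nat -> nat -> nat -> F).
Local Notation E := (affE P form).

Lemma affE_prd0 i j p r : P i j -> P p r ->
  prd 0%:Z (E i j) (E p r) = (j == p)%:R *: E i r - (i == r)%:R *: E p j.
Proof.
move=> Pij Ppr; rewrite {1 2}/affE !insubT.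
rewrite (om_ope (ugen_model (affine_data P form)) 0) /= /bracket_term /= !veval_munit.
by rewrite addr0 scaleNr.
Qed.

Lemma affE_prd1 i j p r : P i j -> P p r ->
  prd 1%:Z (E i j) (E p r) = form i j p r *: vac.
Proof.
move=> Pij Ppr; rewrite /affE !insubT.
by rewrite (om_ope (ugen_model (affine_data P form)) 1) /= addr0.
Qed.

Lemma affE_prdS i j p r m : prd m.+2%:Z (E i j) (E p r) = 0.
Proof.
rewrite /affE; case: insub => [x|]; last by rewrite prd0l.
case: insub => [y|]; last by rewrite prd0r.
by rewrite (om_ope (ugen_model (affine_data P form)) m.+2).
Qed.

Lemma affE_notin i j : ~~ P i j -> E i j = 0.
Proof. by move=> nP; rewrite /affE insubF //=; apply/negbTE. Qed.

End AffineOPE.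

(** * Vectors on which the currents of gl(h) act through the trace *)

Section DiagAction.
Variables (F : numFieldType) (q : seq nat) (k : F).
Local Notation V := (levi_va q k).
Local Notation E := (leviE q k).
Local Notation h := (nval q 1 - nval q 2)%N.

Lemma col_first i : (0 < i <= qpart q 1)%N -> Defs.col q i = 1%N.
Proof.
rewrite /Defs.col /qpart /psum; case: q => [|x s] /=; first by case: i.
by case/andP=> i0 ix; rewrite leqn0 -[i == 0%N]negbK -lt0n i0 take0 addn0 ix.
Qed.

Lemma in_levi_first i j :
  (0 < i <= qpart q 1)%N -> (0 < j <= qpart q 1)%N -> in_levi q i j.
Proof.
move=> hi hj; rewrite /in_levi !col_first // eqxx andbT /in_gl.
have le : (qpart q 1 <= sumn q)%N by rewrite /qpart; case: q => //= x s; apply: leq_addr.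
by move: hi hj => /andP[-> hi] /andP[-> hj] /=; rewrite !(leq_trans _ le).
Qed.

(* For c = 0, the currents of gl(h) act on [v] through the trace only, so that [v]
   commutes with sl(h). *)
Definition diag_act (c : F) (v : V) : Prop :=
  forall m : nat, exists z : V, forall i j, (0 < i <= h)%N -> (0 < j <= h)%N ->
    prd m%:Z (E i j) v = (i == j)%:R *: z + (c * (m == 1%N)%:R) *: E i j.

Lemma diag_act_lin a c d u v : diag_act c u -> diag_act d v -> diag_act (a * c + d) (a *: u + v).
Proof.
move=> hu hv m; have [z hz] := hu m; have [t ht] := hv m.
exists (a *: z + t) => i j hi hj.
rewrite (va_linr (vs_axioms V)) hz // ht // !scalerDr !scalerA addrACA -scalerDl.
by rewrite [_ * a]mulrC mulrDl mulrA.
Qed.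

Lemma diag_act0 : diag_act 0 0.
Proof. by move=> m; exists 0 => i j _ _; rewrite prd0r mul0r scale0r scaler0 addr0. Qed.

Lemma diag_act_vac : diag_act 0 vac.
Proof.
by move=> m; exists 0 => i j _ _; rewrite (va_vacr0 (vs_axioms V)) // mul0r scale0r scaler0 addr0.
Qed.

Lemma diag_actD c d u v : diag_act c u -> diag_act d v -> diag_act (c + d) (u + v).
Proof. by move=> hu hv; have := diag_act_lin 1 hu hv; rewrite mul1r scale1r. Qed.

Lemma diag_actN c u : diag_act c u -> diag_act (- c) (- u).
Proof.
by move=> hu; have := diag_act_lin (-1) hu diag_act0; rewrite !addr0 mulN1r scaleN1r.
Qed.

Lemma diag_actZ a u : diag_act 0 u -> diag_act 0 (a *: u).
Proof. by move=> hu; have := diag_act_lin a hu diag_act0; rewrite mulr0 !addr0. Qed.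

Lemma diag_act_sum I (r : seq I) (P : pred I) (f : I -> V) :
  (forall i, P i -> diag_act 0 (f i)) -> diag_act 0 (\sum_(i <- r | P i) f i).
Proof.
move=> hf; elim/big_rec: _ => [|i x Pi hx]; first exact: diag_act0.
by rewrite -[0]addr0; apply: diag_actD => //; apply: hf.
Qed.

(** In the commutator formula every inner product is delta_{i,j} times a vector independent of i and
    j. This needs c = 0: a summand E_{i,j} would bring in modes that depend on i and j. *)
Lemma diag_act_prd n u v : diag_act 0 u -> diag_act 0 v -> diag_act 0 (prd n u v).
Proof.
move=> hu hv m; have [z hz] := hv m; have [t ht] := choice hu.
exists (prd n u z + \sum_(j < m.+1) gbin F m%:Z j *: prd (m%:Z + n - j%:Z) (t j) v) => i j hi hj.
rewrite prd_commutator hz // mul0r !scale0r !addr0 prdZr scalerDr scaler_sumr; congr (_ + _).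
apply: eq_bigr => s _; rewrite ht // mul0r scale0r addr0 prdZl !scalerA.
by rewrite [_ * gbin _ _ _]mulrC.
Qed.

End DiagAction.

(** * The action of gl(h) on W^(1) and W^(2) *)

Section WGenerators.
Variables (F : numFieldType) (q : seq nat) (k : F).
Hypotheses (q_sorted : sorted geq q) (b1 : bval q 1 = 1%N).
Local Notation V := (levi_va q k).
Local Notation E := (leviE q k).
Local Notation h := (nval q 1 - nval q 2)%N.

Lemma low_rows_le : (h <= qpart q 1)%N.
Proof. by rewrite nval1E // leq_subr. Qed.

Lemma in_levi_low i j : (0 < i <= h)%N -> (0 < j <= h)%N -> in_levi q i j.
Proof.
by move=> /andP[i0 ih] /andP[j0 jh]; apply: in_levi_first; rewrite ?i0 ?j0 /= (leq_trans _ low_rows_le).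
Qed.

Lemma diag_act_leviE p r : (h < p)%N -> (h < r)%N -> diag_act 0 (E p r).
Proof.
move=> hp hr; have [Lpr|/affE_notin e] := boolP (in_levi q p r); last first.
  by rewrite /leviE e; apply: diag_act0.
case=> [|[|m]].
- exists 0 => i j hi hj; rewrite (affE_prd0 _ (in_levi_low hi hj) Lpr).
  have /negPf -> : j != p by lia. have /negPf -> : i != r by lia.
  by rewrite mul0r !scale0r scaler0 subrr addr0.
(* Of the form only delta_{i,j} delta_{p,r} survives, and only if E_{p,r} lies in the first
   block. *)
- exists ((if 1%N == Defs.col q p then ((p == r)%:R : F) else 0) *: vac) => i j hi hj.
  rewrite (affE_prd1 _ (in_levi_low hi hj) Lpr) /levi_form.
  have /negPf -> : j != p by lia.
  rewrite col_first; last by case/andP: hi => -> /leq_trans -> //; apply: low_rows_le.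
  rewrite !mul0r scale0r addr0 scalerA mulr0 add0r; congr (_ *: _).
  by case: ifP; rewrite ?mulr0 // -natrM mulnb.
by exists 0 => i j hi hj; rewrite affE_prdS mul0r scale0r scaler0 addr0.
Qed.

Lemma blockE_first p r : (0 < p <= qpart q 1)%N -> (0 < r <= qpart q 1)%N ->
  blockE q k 1 p r = E p r.
Proof. by move=> hp hr; rewrite /blockE subnn hp hr /psum take0 add0n !subn0. Qed.

(** A column s > 1 has height at most n_2, so its rows all exceed q_1 - n_2 = h. *)
Lemma blockE_low s p r : (1 < s)%N -> (p <= h)%N || (r <= h)%N -> blockE q k s p r = 0.
Proof.
move=> s1 pr; rewrite /blockE; case: ifP => // c; exfalso.
by have := qpart_le_nval2 q_sorted b1 s1; have := nval1E q_sorted b1; move: pr c; lia.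
Qed.

Lemma diag_act_blockE s p r : (h < p)%N -> (h < r)%N -> diag_act 0 (blockE q k s p r).
Proof.
move=> hp hr; rewrite /blockE; case: ifP => c; last exact: diag_act0.
(* Truncated predecessors make s = 0 and s = 1 both denote the first block, without index shift.
   Later blocks start after index q_1, which is at least h. *)
case: s c => [|[|s]] c; try by apply: diag_act_leviE; rewrite /qpart /=; lia.
suff : (qpart q 1 <= psum q s.+1)%N by have := low_rows_le; move: c => /=; move=> *; apply: diag_act_leviE; lia.
by rewrite /qpart /psum; case: q => //= x t; apply: leq_addr.
Qed.

Lemma diag_act_Emode s p r u (v : V) : (h < p)%N -> (h < r)%N -> diag_act 0 v ->
  diag_act 0 (Emode s p r u v).
Proof. by move=> hp hr hv; apply: diag_act_prd => //; apply: diag_act_blockE. Qed.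

Lemma diag_act_W1 p r : (h < p)%N -> (h < r)%N -> diag_act 0 (W1 q k p r).
Proof.
move=> hp hr; apply: diag_act_sum => s _; apply: diag_act_Emode => //.
exact: diag_act_vac.
Qed.

Lemma W1_low i j : (0 < size q)%N -> (0 < i <= h)%N -> (0 < j <= h)%N -> W1 q k i j = E i j.
Proof.
move=> q0 hi hj; rewrite /W1 big_ltn // big_nat_cond big1 ?addr0.
  rewrite /Emode (va_vacr (vs_axioms V)) blockE_first //.
    by case/andP: hi => -> /leq_trans -> //; apply: low_rows_le.
  by case/andP: hj => -> /leq_trans -> //; apply: low_rows_le.
move=> s /andP[/andP[s1 _] _]; rewrite /Emode blockE_low ?prd0l //.
by case/andP: hi => _ ->.
Qed.

(* In W^(2)_{p,p} only the summands E_{u,p}[-1] E_{p,u}[-1] with u a row of the first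
   column alone interact with sl(h).  Because c = 1 here, W^(2)_{p,p} itself is not in
   the coset; differences of two such elements are. *)
Lemma diag_act_low p : (h < p <= qpart q 1)%N ->
  diag_act 1 (\sum_(1 <= u < h.+1) prd (-1) (E u p) (E p u)).
Proof.
move=> /andP[hp pq]; have Lq := @in_levi_first q; have hq := low_rows_le.
(* Commuting E_{i,j} past E_{u,p} gives delta_{j,u} E_{i,p} in mode m - 1; acting on E_{p,u}, it
   gives - delta_{i,u} E_{p,j}, for m = 0 only. Summing over u leaves one term of each kind. *)
have main m i j : (0 < i <= h)%N -> (0 < j <= h)%N ->
    prd m%:Z (E i j) (\sum_(1 <= u < h.+1) prd (-1) (E u p) (E p u)) =
    prd (m%:Z - 1) (E i p) (E p j) - (m == 0%N)%:R *: prd (-1) (E i p) (E p j).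
  move=> hi hj; have Lij : in_levi q i j by apply: in_levi_low.
  rewrite prd_sumr.
  have up u : (0 < u <= h)%N ->
     prd m%:Z (E i j) (prd (-1) (E u p) (E p u)) =
     (j == u)%:R *: prd (m%:Z - 1) (E i p) (E p u)
     - (i == u)%:R *: ((m == 0%N)%:R *: prd (-1) (E u p) (E p j)).
    move=> hu; have Lup : in_levi q u p by apply: Lq; lia.
    have Lpu : in_levi q p u by apply: Lq; lia.
    rewrite prd_commutator addrC; congr (_ + _).
      rewrite big_ord_recl big1 ?addr0 => [|s _].
        rewrite gbin_nat0 scale1r (affE_prd0 _ Lij Lup).
        have /negPf -> : i != p by lia.
        by rewrite scale0r subr0 prdZl.
      rewrite lift0; case: (s : nat) => [|s'].
        rewrite (affE_prd1 _ Lij Lup) /levi_form.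
        have /negPf -> : i != p by lia. have /negPf -> : u != p by lia.
        by rewrite !andbF !mulr0 addr0 if_same scale0r prd0l scaler0.
      by rewrite affE_prdS prd0l scaler0.
    case: m => [|[|m]].
    - rewrite (affE_prd0 _ Lij Lpu); have /negPf -> : j != p by lia.
      by rewrite scale0r sub0r -scaleN1r !prdZr scaleN1r eqxx scale1r.
    - rewrite (affE_prd1 _ Lij Lpu) /levi_form.
      have /negPf -> : j != p by lia. have /negPf -> : p != u by lia.
      by rewrite !andbF !mulr0 addr0 if_same !scale0r prd0r scaler0 oppr0.
    by rewrite affE_prdS prd0r scale0r scaler0 oppr0.
  rewrite (eq_big_nat _ _ (F2 := fun u => (j == u)%:R *: prd (m%:Z - 1) (E i p) (E p u)
     - (i == u)%:R *: ((m == 0%N)%:R *: prd (-1) (E u p) (E p j)))); last first.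
    by move=> u hu; apply: up; lia.
  have pick (x : nat) (f : nat -> V) : (0 < x <= h)%N ->
      \sum_(1 <= u < h.+1) (x == u)%:R *: f u = f x.
    move=> hx; rewrite (bigD1_seq x) ?iota_uniq ?mem_index_iota //=.
    rewrite eqxx scale1r big1 ?addr0 // => u /negPf ux.
    by rewrite eq_sym ux scale0r.
  by rewrite sumrB (pick j (fun u => prd _ _ (E p u))) // (pick i (fun u => _ *: prd _ (E u p) _)).
have inp i j : (0 < i <= h)%N -> (0 < j <= h)%N -> in_levi q i p * in_levi q p j.
  by move=> hi hj; split; apply: Lq; lia.
case=> [|[|[|m]]].
- by exists 0 => i j hi hj; rewrite main // scale1r subrr mulr0 scale0r scaler0 addr0.
(* The bracket of E_{i,p} and E_{p,j} is E_{i,j} - delta_{i,j} E_{p,p}; its first term is the source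
   of c = 1. *)
- exists (- E p p) => i j hi hj; rewrite main // subrr scale0r subr0.
  have [Lip Lpj] := inp _ _ hi hj.
  by rewrite (affE_prd0 _ Lip Lpj) eqxx mulr1 scale1r scalerN addrC.
- exists (alpha q k 1 *: vac) => i j hi hj; rewrite main // scale0r subr0.
  have [Lip Lpj] := inp _ _ hi hj.
  rewrite (_ : 2%:Z - 1 = 1%:Z) // (affE_prd1 _ Lip Lpj) /levi_form !col_first; try by lia.
  have /negPf -> : i != p by lia.
  by rewrite !eqxx /= addr0 mulr0 scale0r addr0 scalerA mulrC.
exists 0 => i j hi hj; rewrite main // scale0r subr0 (_ : m.+3%:Z - 1 = m.+2%:Z); last by lia.
by rewrite affE_prdS mulr0 scale0r scaler0 addr0.
Qed.

(** Since a >= 2, the rows u > q_1 - n_a exceed h, and all summands with u > h have c = 0. For u <=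
    h the factor E^{(r1)}_{u,p} forces r1 = 1, hence r2 = 1; these terms form the sum of
    [diag_act_low] with a minus sign. *)
Lemma diag_act_W2 a p : (1 < a)%N -> (0 < size q)%N ->
  (h < p <= qpart q 1)%N -> diag_act (-1) (W2 q k a p p).
Proof.
move=> a1 q0 hpq; have [hp pq] := andP hpq; have hq := low_rows_le; have n1 := nval1E q_sorted b1.
have na : (nval q a <= nval q 2)%N by apply: nval_anti.
have EE r1 r2 u : (h < u)%N -> diag_act 0 (Emode r1 u p 1 (Emode r2 p u 1 vac) : V).
  by move=> hu; apply: (diag_act_Emode r1 1 hu hp); apply: (diag_act_Emode r2 1 hp hu); apply: diag_act_vac.
rewrite /W2 -(sub0r (1 : F)); apply: diag_actD; last apply: diag_actN.
  rewrite -[0]addr0; apply: diag_actD.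
    rewrite -oppr0; apply: diag_actN; apply: diag_act_sum => s _; apply: diag_actZ.
    by apply: diag_act_Emode => //; apply: diag_act_vac.
  apply: diag_act_sum => r1 _; apply: diag_act_sum => r2 _.
  rewrite big_nat_cond; apply: diag_act_sum => u /andP[/andP[hu _] _]; apply: EE; lia.
rewrite big_ltn // -[1]addr0; apply: diag_actD; last first.
  rewrite big_nat_cond; apply: diag_act_sum => r1 /andP[/andP[r1g _] _].
  apply: diag_act_sum => r2 _; apply: diag_act_sum => u _.
  have [hu|hu] := ltnP h u; first exact: EE.
  by rewrite {1}/Emode blockE_low ?hu // prd0l; apply: diag_act0.
rewrite big_ltn_cond //= -[1]addr0; apply: diag_actD; last first.
  rewrite big_nat_cond big_pred0; first exact: diag_act0.
  by move=> r2 /=; lia.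
(* For r2 = 1 the sum over u starts at q_1 - q_1 + 1 = 1; it is split after u = h. *)
rewrite subnn (big_cat_nat (n := h.+1)) //=; last by lia.
rewrite -[1]addr0; apply: diag_actD; last first.
  rewrite big_nat_cond; apply: diag_act_sum => u /andP[/andP[hu _] _]; apply: EE; lia.
have := diag_act_low hpq; congr diag_act; apply: eq_big_nat => u hu.
by rewrite /Emode (va_vacr (vs_axioms V)) !blockE_first //; lia.
Qed.

(** For a traceless matrix x, the products delta_{i,j} z sum to tr(x) z = 0. *)
Lemma diag_act_coset (v : walg q k) : (0 < size q)%N -> diag_act 0 (val v) ->
  coset_set (slV (k := k)) v.
Proof.
move=> q0 hv; apply: coset_vgen => w r [x [trx ew]]; apply: val_inj.
rewrite [LHS](_ : _ = prd r%:Z (val w) (val v)) // ew prd_suml.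
have [z hz] := hv r.
transitivity (\sum_i x i i *: z); last by rewrite -scaler_suml -/(\tr x) trx scale0r.
apply: eq_bigr => i _; rewrite prd_suml (bigD1 i) // big1 ?addr0 => [|j ji].
  by rewrite prdZl W1_low ?ltn_ord // hz ?ltn_ord // eqxx mul0r scale0r addr0 scale1r [LHS]addr0.
rewrite prdZl W1_low ?ltn_ord // hz ?ltn_ord // eqSS.
have /negPf -> : (i : nat) != j by rewrite eq_sym.
by rewrite mul0r !scale0r addr0 scaler0.
Qed.

End WGenerators.

(** * Linearity of algebra morphisms *)

Section AlgMorphism.
Variables (F : pzRingType) (A B : pzAlgType F) (f : A -> B).
Hypothesis mf : alg_morphism f.

Lemma algm0 : f 0 = 0.
Proof. by have [_ _ /(_ (-1) 0 0)] := mf; rewrite scaler0 addr0 scaleN1r addNr. Qed.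
Lemma algmZ c x : f (c *: x) = c *: f x.
Proof. by have [_ _ /(_ c x 0)] := mf; rewrite !addr0 algm0 addr0. Qed.
Lemma algmD x y : f (x + y) = f x + f y.
Proof. by have [_ _ /(_ 1 x y)] := mf; rewrite !scale1r. Qed.
Lemma algmB x y : f (x - y) = f x - f y.
Proof. by rewrite -scaleN1r algmD algmZ scaleN1r. Qed.
Lemma algm_sum I (r : seq I) (P : pred I) (g : I -> A) :
  f (\sum_(i <- r | P i) g i) = \sum_(i <- r | P i) f (g i).
Proof. by apply: (big_morph f algmD algm0). Qed.

End AlgMorphism.

(** * Limits in the completed enveloping algebra *)

Section Limits.
Variables (F : numFieldType) (V : valg F).
Implicit Types (z : nat -> Uenv V) (w : Uenv V).

Lemma mode_lin c (u v : V) a : mode (c *: u + v) a = c *: mode u a + mode v a.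
Proof.
rewrite -[RHS]/(Uadd (Uscale c _) _) /mode Uscale_pi Uadd_pi.
by apply: Useq_eq => n /=; apply: lmode_lin.
Qed.

Lemma Usmall_lin N c (u v : Uenv V) : Usmall N u -> Usmall N v -> Usmall N (c *: u + v).
Proof.
case=> x -> fx [y -> fy]; exists (sadd (sscale c x) y).
  by rewrite -[LHS]/(Uadd (Uscale c _) _) Uscale_pi Uadd_pi.
by move=> n /=; apply: span_add; [apply: span_scale; apply: fx|apply: fy].
Qed.

Lemma Usmall0 N : Usmall N (0 : Uenv V).
Proof. by exists (s0 V) => // n; apply: Defs.span_nil. Qed.

Lemma Ulim_lin c z z' w w' : Ulim z w -> Ulim z' w' ->
  Ulim (fun n => c *: z n + z' n) (c *: w + w').
Proof.
move=> l l' N; have [M hM] := l N; have [M' hM'] := l' N; exists (maxn M M') => n.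
rewrite geq_max => /andP[/hM h /hM' h'].
by rewrite opprD addrACA -scalerBr; apply: Usmall_lin.
Qed.

Lemma Ulim_const w : Ulim (fun=> w) w.
Proof. by move=> N; exists 0%N => n _; rewrite subrr; apply: Usmall0. Qed.

Lemma Ulim_eq z z' w : Ulim z w -> z =1 z' -> Ulim z' w.
Proof. by move=> l /funext <-. Qed.

Lemma UlimD z z' w w' : Ulim z w -> Ulim z' w' -> Ulim (fun n => z n + z' n) (w + w').
Proof.
by move=> l l'; have := Ulim_lin 1 l l'; rewrite scale1r => /Ulim_eq; apply=> n; rewrite scale1r.
Qed.

Lemma UlimZ c z w : Ulim z w -> Ulim (fun n => c *: z n) (c *: w).
Proof.
move=> l; have := Ulim_lin c l (Ulim_const 0); rewrite addr0 => /Ulim_eq; apply=> n.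
by rewrite addr0.
Qed.

Lemma UlimB z z' w w' : Ulim z w -> Ulim z' w' -> Ulim (fun n => z n - z' n) (w - w').
Proof.
move=> l l'; apply: UlimD => //; rewrite -scaleN1r.
by apply: Ulim_eq (UlimZ (-1) l') _ => n; rewrite scaleN1r.
Qed.

Lemma Ulim_unique z w w' : Ulim z w -> Ulim z w' -> w = w'.
Proof.
move=> l l'; apply/eqP; rewrite -subr_eq0; apply/eqP; apply: Usmall_eq0 => N.
have [M /(_ M (leqnn M))] := UlimB l l' N; rewrite subrr sub0r => h.
by have := Usmall_lin (-1) h (Usmall0 N); rewrite scaleN1r opprK addr0.
Qed.

(** The image of [ULV] in the completion, where finite partial sums live. It is a relation because a
    constant sequence is Cauchy only for elements of bounded degree. *)
Definition Uconst (x : ULV V) (w : Uenv V) : Prop :=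
  exists cx : Ucauchy (fun=> x), w = \pi_(Uenv_sort V) (USeq cx).

Lemma Uconst0 : Uconst 0 0.
Proof. by exists (Ucauchy0 V). Qed.

Lemma UconstD x y (u v : Uenv V) : Uconst x u -> Uconst y v -> Uconst (x + y) (u + v).
Proof.
case=> cx -> [cy ->]; exists (Ucauchy_add cx cy).
by rewrite -[LHS]/(Uadd _ _) Uadd_pi; apply: Useq_eq.
Qed.

Lemma UconstM x y (u v : Uenv V) : Uconst x u -> Uconst y v -> Uconst (x * y) (u * v).
Proof.
case=> cx -> [cy ->]; exists (Ucauchy_mul cx cy).
by rewrite -[LHS]/(Umul _ _) Umul_pi; apply: Useq_eq.
Qed.

Lemma Uconst_mode (u : V) a : Uconst (lmode u a) (mode u a).
Proof. by exists (Ucauchy_lmode u a). Qed.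

Lemma Uconst_sum I (r : seq I) (f : I -> ULV V) (g : I -> Uenv V) :
  (forall i, Uconst (f i) (g i)) -> Uconst (\sum_(i <- r) f i) (\sum_(i <- r) g i).
Proof.
move=> fg; elim: r => [|i r IH]; first by rewrite !big_nil; apply: Uconst0.
by rewrite !big_cons; apply: UconstD.
Qed.

(** Bounded degrees together with the s-th term lying in [Ufil s] make the partial sums a Cauchy
    sequence, whose class is the limit. *)
Lemma Ulim_series (f : nat -> ULV V) (g : nat -> Uenv V) D :
  (forall s, Uconst (f s) (g s)) -> (forall s, Ubounded D (f s)) ->
  (forall s, Ufil s (f s)) -> exists w, Ulim (fun n => \sum_(0 <= s < n) g s) w.
Proof.
move=> fg bf ff; pose X n := \sum_(0 <= s < n) f s.
have tail N m n : (N <= m)%N -> (N <= n)%N -> Ufil N (X m - X n).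
  wlog nm : m n / (n <= m)%N => [IH|] Nm Nn.
    case/orP: (leq_total n m) => h; first exact: IH.
    by rewrite -opprB; apply: span_opp; apply: IH.
  rewrite /X (big_cat_nat (n := n) (p := m)) //= addrAC subrr add0r big_nat_cond.
  apply: span_sum => s /andP[/andP[ns _] _]; apply: Ufil_le (ff s).
  exact: leq_trans Nn ns.
have bX n : Ubounded D (X n) by apply: span_sum => s _; apply: bf.
have cX : Ucauchy X by split; [exists D|move=> N; exists N => m n; apply: tail].
(* [Usmall] constrains every index of a representative, so the limit is represented by a sequence
   whose entries before N are replaced by the N-th. *)
have cX' N : Ucauchy (fun n => X (maxn N n)).
  split; first by exists D.
  by move=> N'; exists N' => m n hm hn; apply: tail; rewrite leq_max ?hm ?hn orbT.
exists (\pi_(Uenv_sort V) (USeq cX)) => N; exists N => n Nn.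
have -> : \pi_(Uenv_sort V) (USeq cX) = \pi_(Uenv_sort V) (USeq (cX' N)).
  apply/Uenv_eq => N'; exists (fun=> 0); first exact: Uideal0.
  exists N => m /maxn_idPr e /=; rewrite e subrr subr0; exact: Defs.span_nil.
have [cn ->] : Uconst (X n) (\sum_(0 <= s < n) g s) by apply: Uconst_sum.
exists (sadd (USeq cn) (sscale (-1) (USeq (cX' N)))).
  by rewrite -[LHS]/(Uadd _ (Uscale (-1) _)) Uscale_pi Uadd_pi.
by move=> m /=; rewrite scaleN1r; apply: tail => //; apply: leq_maxl.
Qed.

(** In weight 1 the degree of u t^a is -a. Each product thus has degree 0, and its right factor has
    degree at most -s. *)
Lemma Ulim_quadratic (v v' : nat -> V) (e e' : nat -> int) (a b : nat) :
  (forall u, Defs.hom 1 false (v u)) -> (forall u, Defs.hom 1 false (v' u)) ->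
  (forall s, e s = - e' s) -> (forall s, s%:Z <= e' s) ->
  exists w, Ulim (fun n =>
    \sum_(0 <= s < n) \sum_(a <= u < b) mode (v u) (e s) * mode (v' u) (e' s)) w.
Proof.
move=> hv hv' ee es.
apply: (Ulim_series (f := fun s => \sum_(a <= u < b) lmode (v u) (e s) * lmode (v' u) (e' s))
  (D := 0)) => s.
- by apply: Uconst_sum => u; apply: UconstM; apply: Uconst_mode.
- apply: span_sum => u _; apply: span_inc.
  have := mono_mulm (mono_lmode (e s) (hv u)) (mono_lmode (e' s) (hv' u)).
  by move=> h; eexists; split; last exact: h; rewrite ee; lia.
apply: span_sum => u _; apply: span_inc.
exists (lmode (v u) (e s)), (1 - e' s - 1), (lmode (v' u) (e' s)); split=> //.
  by have := es s; lia.
exact: mono_lmode (hv' u).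
Qed.

End Limits.

(** The induced map is continuous since it preserves degrees and hence the filtration [Ufil]. *)
Lemma Uenv_map_Ulim (F : numFieldType) (V W : valg F) (f : V -> W) (mf : va_morphism f) z w :
  Ulim z w -> Ulim (fun n => Uenv_map mf (z n)) (Uenv_map mf w).
Proof.
move=> l N; have [M hM] := l N; exists M => n /hM[x e fx].
rewrite -(algmB (Uenv_map_morph mf)) e; exists (Useq_map mf x); first exact: Uenv_map_pi.
by move=> m /=; apply: ULV_map_fil.
Qed.

(** * Generators of the affine Yangian *)

Section YangianGenerators.
Variables (F : numFieldType) (n : nat) (hbar eps : F).
Local Notation Y := (Yangian n hbar eps).
Local Notation gen := (Ygenerator (n := n) hbar eps).

(** Commutators of X^+_{i,0} and X^-_{i,0} give H_{i,0}; those of the modified H_{i,1}, i > 0, with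
    X_{j,0} give all X_{j,1}; finally X^+_{i,1} and X^-_{i,0} give H_{i,1}, including i = 0. *)
Lemma Yangian_gen_ind (P : Y -> Prop) : (2 < n)%N ->
  (forall s i, P (gen (YX s i false))) -> (forall i : 'I_n, (0 < i)%N -> P (gen (YH i true))) ->
  (forall c, P (c *: (1 : Y))) -> (forall x y : Y, P x -> P y -> P (x + y)) ->
  (forall x y : Y, P x -> P y -> P (x * y)) -> forall y, P y.
Proof.
move=> n3 PX0 PH1 P1 PD PM.
have PZ c x : P x -> P (c *: x).
  by move=> Px; rewrite -[x]mul1r pzalg_scaleAl; apply: PM.
have PB x y : P x -> P y -> P (x - y).
  by move=> Px Py; apply: PD => //; rewrite -scaleN1r; apply: PZ.
have PC x y : P x -> P y -> P (comm x y) by move=> Px Py; apply: PB; apply: PM.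
have R := @Yangian_rel F n hbar eps.
have PH0 i : P (gen (YH i false)).
  have := PC _ _ (PX0 true i) (PX0 false i).
  by rewrite (Y_XX00 R) eqxx.
have PX1 s j : P (gen (YX s j true)).
  suff [i [i0 nij nji cij]] : exists i : 'I_n,
      [/\ (0 < i)%N, ~~ Defs.wrap i j, ~~ Defs.wrap j i & cartan i j != 0].
    have nz : sg F s * (cartan i j)%:~R != 0.
      by rewrite mulf_neq0 ?intr_eq0 // /sg; case: s; rewrite ?oppr_eq0 oner_eq0.
    rewrite -[gen _]scale1r -(mulVf nz) -scalerA -(Y_H1X R) //.
    apply/PZ/PC => //; apply: PB; first exact: PH1.
    by apply: PZ; rewrite expr2; apply: PM.
  (* For j > 0 take i = j. For j = 0 take i = 1, a neighbour of 0 that is not n - 1 because n >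
     2. *)
  have [j0|j0] := posnP j; last first.
    exists j; rewrite /Defs.wrap /cartan eqxx; split=> //; rewrite negb_and -lt0n j0 //.
  have n1 : (1 < n)%N by lia.
  exists (Ordinal n1); rewrite /Defs.wrap /cartan /= j0; split=> //.
    by lia.
  by rewrite -val_eqE /= j0 /= (modn_small n1) eqxx orbT.
apply: palg_ind => // -[s i [|]|i [|]]; rewrite -/(gen _) //.
have := PC _ _ (PX1 true i) (PX0 false i).
by rewrite (Y_XX10 R) eqxx.
Qed.

End YangianGenerators.

(** * Lifting the images of the generators to the coset *)

Section Coset.
Variables (F : numFieldType) (q : seq nat) (k : F).
Hypotheses (q_sorted : sorted geq q) (b1 : bval q 1 = 1%N).
Local Notation W := (walg q k).
Local Notation C := (walg_coset q k).
Local Notation incl := (Uenv_map (coset_incl q k)).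

Lemma hom_W1 p r : Defs.hom 1 false (W1 q k p r).
Proof.
have ax := vs_axioms (levi_va q k).
apply: hom_sum => s _; rewrite /Emode (va_vacr ax) /blockE.
case: ifP => _; last exact: (va_hom0 ax).
rewrite /leviE /affE; case: insub => [z|]; last exact: (va_hom0 ax).
exact: (om_hom (ugen_model (affine_data (in_levi q) (levi_form q k))) z).
Qed.

Lemma coset_lift (u : W) : (0 < size q)%N -> diag_act 0 (val u) -> exists v : C, val v = u.
Proof.
move=> q0 /(diag_act_coset q_sorted b1 q0) cu.
by exists (to_subva (coset_subva (vgen_subva (@slW_hom _ q k))) cu).
Qed.

Variables (a : nat).
Hypotheses (a_bounds : (1 < a <= ndist q)%N).
Local Notation d := (nval q 1 - nval q a)%N.
Local Notation n := (nval q a - nval q a.+1)%N.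

(** As a >= 2, n_a <= n_2 and so d >= h: the whole a-th block lies beyond the rows of gl(h). *)
Lemma block_bounds p : (0 < p <= n)%N ->
  (nval q 1 - nval q 2 < d + p)%N && (d + p <= qpart q 1)%N.
Proof.
move=> hp; have := nval1E q_sorted b1; have := @nval_anti q q_sorted 2 a.
by have := @nval_anti q q_sorted 1 a; case/andP: a_bounds => -> _; lia.
Qed.

Lemma size_q_gt0 : (0 < size q)%N.
Proof.
by case/andP: a_bounds => a1 /(leq_trans a1); rewrite /ndist; case: q.
Qed.

Variables (w1 w2 : nat -> nat -> W).
Hypothesis wE : forall p r, (d < p <= d + n)%N -> (d < r <= d + n)%N ->
  val (w1 p r) = W1 q k p r /\ val (w2 p r) = W2 q k a p r.

(** [Ulim_quadratic] asks for weight 1 at all indices, so the lift is extended by 0 outside the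
    block. *)
Lemma w1_lift : exists v : nat -> nat -> C, forall p r, Defs.hom 1 false (v p r) /\
  ((0 < p <= n)%N -> (0 < r <= n)%N -> val (v p r) = w1 (d + p)%N (d + r)%N).
Proof.
suff /choice[v hv] : forall x : nat * nat, exists v : C, Defs.hom 1 false v /\
    ((0 < x.1 <= n)%N -> (0 < x.2 <= n)%N -> val v = w1 (d + x.1)%N (d + x.2)%N).
  by exists (fun p r => v (p, r)) => p r; apply: (hv (p, r)).
case=> p r /=; have [/andP[hp hr]|npr] := boolP ((0 < p <= n)%N && (0 < r <= n)%N); last first.
  exists 0; split; first exact: (va_hom0 (vs_axioms C)).
  by move=> hp hr; rewrite hp hr in npr.
have [wpr _] : val (w1 (d + p)%N (d + r)%N) = W1 q k (d + p) (d + r) /\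
    val (w2 (d + p)%N (d + r)%N) = W2 q k a (d + p) (d + r) by apply: wE; lia.
have [||v ev] := @coset_lift (w1 (d + p)%N (d + r)%N); first exact: size_q_gt0.
  by rewrite wpr; apply: diag_act_W1 => //; [have := block_bounds hp|have := block_bounds hr];
    case/andP.
exists v; split=> //; suff: Defs.hom 1 false (val (val v) : levi_va q k) by [].
by rewrite ev wpr; apply: hom_W1.
Qed.

(** Both elements have c = -1, which cancels in the difference. *)
Lemma w2_lift i : (0 < i < n)%N ->
  exists g : C, val g = w2 (d + i)%N (d + i)%N - w2 (d + i.+1)%N (d + i.+1)%N.
Proof.
move=> hi; apply: coset_lift; first exact: size_q_gt0.
have [_ e] : val (w1 (d + i)%N (d + i)%N) = W1 q k (d + i) (d + i) /\
    val (w2 (d + i)%N (d + i)%N) = W2 q k a (d + i) (d + i) by apply: wE; lia.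
have [_ e'] : val (w1 (d + i.+1)%N (d + i.+1)%N) = W1 q k (d + i.+1) (d + i.+1) /\
    val (w2 (d + i.+1)%N (d + i.+1)%N) = W2 q k a (d + i.+1) (d + i.+1) by apply: wE; lia.
rewrite raddfB /= e e' -(subrr (-1 : F)); apply: diag_actD; last apply: diag_actN.
  by apply: diag_act_W2 => //; [case/andP: a_bounds|exact: size_q_gt0|apply: block_bounds; lia].
by apply: diag_act_W2 => //; [case/andP: a_bounds|exact: size_q_gt0|apply: block_bounds; lia].
Qed.

Lemma mode_image p r b : (0 < p <= n)%N -> (0 < r <= n)%N ->
  exists z, mode (w1 (d + p)%N (d + r)%N) b = incl z.
Proof.
move=> hp hr; have [v /(_ p r)[_ /(_ hp hr) <-]] := w1_lift.
by exists (mode (v p r) b); rewrite Uenv_map_mode.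
Qed.

(** The limit is first built in the enveloping algebra of the coset and then carried over by
    continuity. *)
Lemma PhiH_image (hbar : F) i : (0 < i < n)%N ->
  exists z, Ulim (PhiH hbar a w1 w2 i) (incl z).
Proof.
move=> hi; have [v hv] := w1_lift; have [g eg] := w2_lift hi.
have vh p r : Defs.hom 1 false (v p r) by have [] := hv p r.
have m := Uenv_map_morph (coset_incl q k).
have vE p r b : (0 < p <= n)%N -> (0 < r <= n)%N ->
    mode (w1 (d + p)%N (d + r)%N) b = incl (mode (v p r) b).
  by move=> hp hr; rewrite Uenv_map_mode; have [_ ->] := hv p r.
have gE : mode (w2 (d + i)%N (d + i)%N) 1 - mode (w2 (d + i.+1)%N (d + i.+1)%N) 1 =
    incl (mode g 1).
  by rewrite Uenv_map_mode eg addrC -!scaleN1r addrC [in RHS]addrC mode_lin addrC.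
have tE (j c c' : nat) (e e' : nat -> int) S : (0 < j <= n)%N -> (0 < c)%N -> (c' <= n.+1)%N ->
    \sum_(0 <= s < S) \sum_(c <= u < c')
       mode (w1 (d + j)%N (d + u)%N) (e s) * mode (w1 (d + u)%N (d + j)%N) (e' s) =
    incl (\sum_(0 <= s < S) \sum_(c <= u < c') mode (v j u) (e s) * mode (v u j) (e' s)).
  move=> hj hc hc'; rewrite (algm_sum m); apply: eq_bigr => s _.
  rewrite (algm_sum m); apply: eq_big_nat => u hu.
  have [_ -> _] := m; rewrite !vE //; lia.
(* [t1] to [t4] are the four infinite sums of [PhiH], formed with lifted currents; [base] collects
   the finite terms. *)
have [t1 T1] := Ulim_quadratic 1 i.+1 (vh i) (vh^~ i) (e := fun s => - s%:Z) (e' := fun s => s%:Z)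
  (fun=> erefl) (fun=> lexx _).
have ee s : - s%:Z - 1 = - (s%:Z + 1) by lia.
have le s : s%:Z <= s%:Z + 1 by lia.
have [t2 T2] := Ulim_quadratic i.+1 n.+1 (vh i) (vh^~ i) ee le.
have [t3 T3] := Ulim_quadratic 1 i.+1 (vh i.+1) (vh^~ i.+1) (e := fun s => - s%:Z)
  (e' := fun s => s%:Z) (fun=> erefl) (fun=> lexx _).
have [t4 T4] := Ulim_quadratic i.+1 n.+1 (vh i.+1) (vh^~ i.+1) ee le.
pose base := - hbar *: mode g 1 - (i%:R / 2 * hbar) *: (mode (v i i) 0 - mode (v i.+1 i.+1) 0)
  - hbar *: (mode (v i i) 0 * mode (v i.+1 i.+1) 0).
have := Uenv_map_Ulim (coset_incl q k) (UlimB (UlimB (UlimD (UlimD (Ulim_const base)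
  (UlimZ hbar T1)) (UlimZ hbar T2)) (UlimZ hbar T3)) (UlimZ hbar T4)).
set z := (X in incl X) => L; exists z; apply: Ulim_eq L _ => S.
rewrite !(algmB m, algmD m, algmZ m); have [_ mM _] := m; rewrite mM.
rewrite /PhiH gE !vE ?tE //; lia.
Qed.

End Coset.

Theorem theorem7p2 (R : realType) (q : seq nat) (k hbar eps : R[i])
    (q_sorted : sorted geq q) (q_pos : all (leq 1) q)
    (hbar_neq0 : hbar != 0)
    (b1_eq1 : bval q 1 = 1%N)
    (epsE : eps = hbar * (k + (sumn q)%:R - (qpart q (size q))%:R))
    (n_ge3 : forall c : nat, (1 <= c <= ndist q)%N -> (3 <= nval q c - nval q c.+1)%N)
    (kNq_neq0 : k + (sumn q)%:R - (qpart q (size q))%:R != 0) :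
  forall a : nat, (2 <= a <= ndist q)%N ->
  forall Phi : Yangian (nval q a - nval q a.+1) hbar
                 (eps - ((nval q a)%:R - (qpart q (size q))%:R) * hbar) ->
               Uenv (walg q k),
  is_Phi Phi ->
  forall y, exists z : Uenv (walg_coset q k), Phi y = Uenv_map (coset_incl q k) z.
Proof.
move=> a ha Phi [mPhi [w1 [w2 [wE X0 Xi H1]]]].
have mI := Uenv_map_morph (coset_incl q k).
have n3 : (2 < nval q a - nval q a.+1)%N by apply: n_ge3; case/andP: ha => /ltnW ->.
have img := mode_image q_sorted b1_eq1 ha wE.
apply: Yangian_gen_ind => // [s i|i i0|c|x y [z ez] [t et]|x y [z ez] [t et]].
- have [i0|i0] := posnP i.
    have [ep em] := X0 i i0; case: s; [rewrite ep|rewrite em]; rewrite -[(nval q 1 - nval q a).+1]addn1; apply: img; lia.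
  have [ep em] := Xi i i0; have := ltn_ord i.
  by case: s => hi; [rewrite ep|rewrite em]; rewrite -addnS; apply: img; lia.
(* [Phi] of H_{i,1} is known only as a limit of [PhiH]; uniqueness of limits identifies it with the
   image of [z]. *)
- have [|z Hz] := PhiH_image q_sorted b1_eq1 ha wE hbar (i := i); first by rewrite i0 /=.
  by exists z; apply: Ulim_unique (H1 i i0) Hz.
- exists (c *: (1 : Uenv (walg_coset q k))); rewrite (algmZ mPhi) (algmZ mI).
  by case: mPhi mI => -> _ _ [-> _ _].
- by exists (z + t); rewrite (algmD mPhi) (algmD mI) ez et.
by exists (z * t); case: mPhi mI => _ -> _ [_ -> _]; rewrite ez et.
Qed.
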